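(* Let $f$ be an SGF on $\mathbb{R}^d$ or $\mathbb{Z}^d$ with covariance kernel $K$ and spectral measure $\mu$, and suppose that $\lim_{\delta\to0}\frac{\log\mu[B(\delta)]}{\log\delta}=\alpha$ for some $\alpha\in(0,\infty]$. Suppose that at least one of the following holds: (1) $\alpha>d-1$ and $K\ge0$; or (2) $\alpha\in(0,d-1)$, and $K$ is radial and eventually non-negative. Then for every $\epsilon>0$, $\mathrm{Cap}_f(B(T+T^{1-\epsilon}))\sim\mathrm{Cap}_f(B(T))$ as $T\to\infty$.
   Context: An SGF on $\mathbb{R}^d$ or $\mathbb{Z}^d$ is a continuous (in the case of $\mathbb{R}^d$), centred, non-degenerate, stationary Gaussian field $f$. Its covariance kernel is $K(x)=\mathbb{E}[f(0)f(x)]$; its spectral measure $\mu$ is the unique non-negative, finite, symmetric measure with $K=\mathcal{F}[\mu]$, where $\mathcal{F}[\mu](x)=\int e^{-2\pi i\langle\lambda,x\rangle}d\mu(\lambda)$. It lives on $\mathbb{R}^d$ for fields on $\mathbb{R}^d$, and on the torus $\mathbb{R}^d/\mathbb{Z}^d$ for fields on $\mathbb{Z}^d$. $B(r)$ is the closed Euclidean ball of radius $r$ about the origin; for fields on $\mathbb{Z}^d$, a spatial domain $B(T)$ is understood as $B(T)\cap\mathbb{Z}^d$. Radial means depending only on the distance from the origin. $K$ is eventually non-negative if there is $r>0$ with $K(x)\ge0$ for all $|x|\ge r$. Capacity: for compact $D$, $$\mathrm{Cap}_f(D)=\Big(\min_{\nu\in\mathcal{P}(D)}\int_D\int_DK(x-y)\,d\nu(x)\,d\nu(y)\Big)^{-1}\in(0,\infty],$$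 where $\mathcal{P}(D)$ is the set of Borel probability measures on $D$. $a(T)\sim b(T)$ means $a(T)/b(T)\to1$. *)

(* Defs.v *)
From HB Require Import structures.
From mathcomp Require Import all_boot all_order all_algebra.
From mathcomp Require Import all_classical all_reals all_analysis.
From mathcomp Require Import complex.

Set Implicit Arguments.
Unset Strict Implicit.
Unset Printing Implicit Defensive.

Import Order.TTheory GRing.Theory Num.Theory.
Import numFieldNormedType.Exports.

Local Open Scope classical_set_scope.
Local Open Scope ring_scope.
Local Open Scope quotient_scope.

Definition borel (T : ptopologicalType) := g_sigma_algebraType (@open T).

Definition lattice_space (d : nat) : Type := discrete_topology 'rV[int]_d.
HB.instance Definition _ d := Topological.on (lattice_space d).
HB.instance Definition _ d := isPointed.Build (lattice_space d) (0 : 'rV[int]_d).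

Section geometry.
Context {R : realType} {d : nat}.
Implicit Types (x y : 'rV[R]_d) (r : R).

(* The library's norm on 'rV[R]_d is the sup norm. *)
Definition dot x y : R := \sum_(i < d) x ord0 i * y ord0 i.
Definition enorm x : R := Num.sqrt (dot x x).
Definition eball r : set 'rV[R]_d := [set x | enorm x <= r].

Definition of_lattice (n : 'rV[int]_d) : 'rV[R]_d := map_mx intr n.
Definition lattice_norm (n : 'rV[int]_d) : R := enorm (of_lattice n).
Definition lattice_ball r : set 'rV[int]_d := of_lattice @^-1` eball r.

End geometry.

Section torus.
Context (R : realType) (d : nat).
Implicit Types (x y : 'rV[R]_d).

Definition lattice_eq x y : bool :=
  [forall i, x ord0 i - y ord0 i \is a Num.int].

Lemma lattice_eq_equiv : equiv_class_of lattice_eq.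
Proof.
split=> [x|x y|y x z].
- by apply/forallP => i; rewrite subrr rpred0.
- by apply: eq_forallb => i; rewrite -opprB rpredN.
- move=> /forallP xy /forallP yz; apply/forallP => i.
  by rewrite -(subrKA (y ord0 i)) rpredD.
Qed.

Canonical lattice_eq_canonical := EquivRelPack lattice_eq_equiv.

Definition torus := quotient_topology {eq_quot lattice_eq}.
HB.instance Definition _ := PointedTopological.on torus.
HB.instance Definition _ := Quotient.on torus.

Definition torus_opp (q : torus) : torus := \pi_torus (- repr q).

(* The flat distance from q to 0 is the least Euclidean norm of a
   representative of q, so this is the closed ball about 0. *)
Definition torus_ball (r : R) : set torus := \pi_torus @` eball r.

End torus.

Section gaussian_fields.
Context d0 (Omega : measurableType d0) (R : realType) (P : probability Omega R).
Context {X : zmodType}.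
Implicit Types f : X -> {RV P >-> R}.

(* Gaussian variables of variance 0 are allowed; normal_prob m 0 is a junk
   value. *)
Definition gaussian_rv (Y : Omega -> R) : Prop :=
  exists m s : R, forall A : set R, measurable A ->
    P (Y @^-1` A) = if s == 0 then \d_m A else normal_prob m s A.

Definition gaussian_field f : Prop :=
  forall (n : nat) (x : 'I_n -> X) (c : 'I_n -> R),
    gaussian_rv (fun w => \sum_(i < n) c i * f (x i) w).

Definition centred_field f : Prop := forall x, ('E_P[f x] = 0)%E.

Definition nondegenerate_field f : Prop := forall x, ('V_P[f x] != 0)%E.

(* Equality of the finite-dimensional laws, tested on measurable boxes. *)
Definition stationary_field f : Prop :=
  forall (n : nat) (x : 'I_n -> X) (h : X) (A : 'I_n -> set R),
    (forall i, measurable (A i)) ->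
    P [set w | forall i, A i (f (x i + h) w)] =
    P [set w | forall i, A i (f (x i) w)].

Record is_sgf f : Prop := IsSGF {
  sgf_gaussian : gaussian_field f ;
  sgf_centred : centred_field f ;
  sgf_nondegenerate : nondegenerate_field f ;
  sgf_stationary : stationary_field f }.

Definition cov_kernel f (x : X) : R := fine 'E_P[fun w => f 0 w * f x w].

End gaussian_fields.

Section sgf_on_Rd_and_Zd.
Context d0 (Omega : measurableType d0) (R : realType) (P : probability Omega R).
Context (d : nat).

Definition sgf_Rd (f : 'rV[R]_d -> {RV P >-> R}) : Prop :=
  is_sgf f /\ {ae P, forall w, continuous (fun x : 'rV[R]_d => f x w : R)}.

Definition sgf_Zd (f : 'rV[int]_d -> {RV P >-> R}) : Prop := is_sgf f.

End sgf_on_Rd_and_Zd.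

Section spectral_measure.
Context {R : realType}.

Definition cis (t : R) : R[i] := (cos t +i* sin t)%C.

Definition cintegral d0 (T : measurableType d0)
    (mu : {measure set T -> \bar R}) (g : T -> R[i]) : R[i] :=
  ((\int[mu]_t complex.Re (g t)) +i* (\int[mu]_t complex.Im (g t)))%C.

Context {d : nat}.

Definition fourier_Rd (mu : {finite_measure set (borel 'rV[R]_d) -> \bar R})
    (x : 'rV[R]_d) : R[i] :=
  cintegral mu (fun l => cis (- 2 * pi * dot l x)).

(* For x in the lattice the integrand does not depend on the representative. *)
Definition fourier_torus (mu : {finite_measure set (borel (torus R d)) -> \bar R})
    (x : 'rV[int]_d) : R[i] :=
  cintegral mu (fun q => cis (- 2 * pi * dot (repr (q : torus R d)) (of_lattice x))).

Definition spectral_measure_Rd (K : 'rV[R]_d -> R)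
    (mu : {finite_measure set (borel 'rV[R]_d) -> \bar R}) : Prop :=
  (forall A : set (borel 'rV[R]_d), measurable A ->
    mu ((fun l : 'rV[R]_d => - l) @^-1` A) = mu A) /\
  (forall x, (K x)%:C%C = fourier_Rd mu x).

Definition spectral_measure_torus (K : 'rV[int]_d -> R)
    (mu : {finite_measure set (borel (torus R d)) -> \bar R}) : Prop :=
  (forall A : set (borel (torus R d)), measurable A ->
    mu (@torus_opp R d @^-1` A) = mu A) /\
  (forall x, (K x)%:C%C = fourier_torus mu x).

End spectral_measure.

Section capacity.
Context {R : realType} {X : ptopologicalType}.
Local Open Scope ereal_scope.

(* Probability measures on a Borel set D are identified with the probability
   measures on X giving D mass 1. The energies are minimised over these, and
   0^-1 = +oo. *)
Definition energy (k : X -> X -> R) (D : set X) (nu : probability (borel X) R)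
    : \bar R :=
  \int[nu]_(x in D) \int[nu]_(y in D) (k x y)%:E.

Definition capacity (k : X -> X -> R) (D : set X) : \bar R :=
  (ereal_inf [set energy k D nu |
                nu in [set nu : probability (borel X) R | nu D = 1]])^-1.

End capacity.

Definition Cap_Rd {R : realType} {d : nat} (K : 'rV[R]_d -> R)
    (D : set 'rV[R]_d) : \bar R :=
  capacity (fun x y : 'rV[R]_d => K (x - y)) D.

Definition Cap_Zd {R : realType} {d : nat} (K : 'rV[int]_d -> R)
    (D : set 'rV[int]_d) : \bar R :=
  @capacity R (lattice_space d)
    (fun x y : 'rV[int]_d => K (x - y)) D.

Section asymptotics.
Context {R : realType}.

(* lne 0 = -oo, so alpha = +oo when mB vanishes near 0. *)
Definition log_exponent (mB : R -> \bar R) (alpha : \bar R) : Prop :=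
  (lne (mB delta) / (ln delta)%:E)%E @[delta --> 0^'+] --> alpha.

Definition asymp_equiv (a b : R -> \bar R) : Prop :=
  (a T / b T)%E @[T --> +oo%R] --> 1%E.

Definition radial {X : Type} (nrm : X -> R) (K : X -> R) : Prop :=
  forall x y, nrm x = nrm y -> K x = K y.

Definition eventually_nonneg {X : Type} (nrm : X -> R) (K : X -> R) : Prop :=
  exists2 r : R, 0 < r & forall x, r <= nrm x -> 0 <= K x.

End asymptotics.

(* Main.v *)
(** The energy of [nu] is [<v, v>], where [v] is the transform of [nu] in
    [L^2(mu)], and integer translations of [nu] act on [v] as isometries. It
    suffices to turn a measure [nu] on [B(T + w)], with [w] much smaller than
    [T], into a measure on [B(T)] whose energy is at most [1 + kappa] times
    larger. Cut [nu] into [2 d] pieces [v i] according to the coordinate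
    direction closest to the position, after averaging the cut over a box of
    side [a >= w] of integer translations. For a scale [b] between [a] and [T],
    move each piece inwards by [6 d^2 b] and average the result over a box of
    side [b]: this gives a measure on [B(T)] with transform [W b], whose energy
    may be larger than that of [nu] by a constant factor. A vector which varies
    slowly at the scale [b] does not see the displacements, so it has almost the
    same inner product with [W b] as with [v]; in particular this holds for
    [W b'] with [b'] much larger than [b]. As in the proof of the Banach-Saks
    theorem, a convex combination of the [W b] over sufficiently many separated
    scales therefore has energy at most [1 + kappa] times that of [v].

    The norms of the pieces must be bounded by the norm of [v]. This is clear
    when [K >= 0]. When [K] is only non-negative outside a ball, the averaging
    of the cut dilutes the negative part of [K] to [O(T^-d)], whereas the
    frequencies below [1 / T] show that the minimal energy on [B(T)] is at least
    of order [T^-beta] for any [beta > alpha]. *)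

Require Import Defs.
From HB Require Import structures.
From mathcomp Require Import all_boot all_order all_algebra.
From mathcomp Require Import all_classical all_reals all_analysis.
From mathcomp Require complex.
From mathcomp Require Import measurable_realfun ring lra.

Set Implicit Arguments.
Unset Strict Implicit.
Unset Printing Implicit Defensive.

Import Order.TTheory GRing.Theory Num.Theory.
Import numFieldNormedType.Exports.

Local Open Scope classical_set_scope.
Local Open Scope ring_scope.

(** * Isometric lattice actions on semi-inner product spaces *)

Record semi_inner (R : realType) (H : lmodType R) := SemiInner {
  ip :> H -> H -> R ;
  ipC : forall x y, ip x y = ip y x ;
  ipDl : forall x y z, ip (x + y) z = ip x z + ip y z ;
  ipZl : forall a x y, ip (a *: x) y = a * ip x y ;
  ip_ge0 : forall x, 0 <= ip x x }.

Section SemiNorm.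
Context (R : realType) (H : lmodType R) (g : semi_inner H).
Implicit Types (x y z : H) (a : R).

Definition nrm x := Num.sqrt (g x x).

Lemma ipDr x y z : g x (y + z) = g x y + g x z.
Proof. by rewrite ipC ipDl !(ipC g x). Qed.

Lemma ipZr a x y : g x (a *: y) = a * g x y.
Proof. by rewrite ipC ipZl ipC. Qed.

Lemma ip0l y : g 0 y = 0.
Proof. by rewrite -(scale0r 0) ipZl mul0r. Qed.

Lemma ipBl x y z : g (x - y) z = g x z - g y z.
Proof. by rewrite -scaleN1r ipDl ipZl mulN1r. Qed.

Lemma ipBr x y z : g z (x - y) = g z x - g z y.
Proof. by rewrite ipC ipBl !(ipC g z). Qed.

Lemma ip_suml (I : Type) (r : seq I) (P : pred I) (F : I -> H) y :
  g (\sum_(i <- r | P i) F i) y = \sum_(i <- r | P i) g (F i) y.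
Proof.
by elim/big_rec2: _ => [|i u w _ <-]; rewrite ?ip0l // ipDl.
Qed.

Lemma ip_sumr (I : Type) (r : seq I) (P : pred I) (F : I -> H) y :
  g y (\sum_(i <- r | P i) F i) = \sum_(i <- r | P i) g y (F i).
Proof. by rewrite ipC ip_suml; apply: eq_bigr => i _; rewrite ipC. Qed.

Lemma nrm_ge0 x : 0 <= nrm x.
Proof. exact: sqrtr_ge0. Qed.

Lemma sqr_nrm x : nrm x ^+ 2 = g x x.
Proof. by rewrite sqr_sqrtr // ip_ge0. Qed.

Lemma sqr_ip_le x y : g x y ^+ 2 <= g x x * g y y.
Proof.
have key t : 0 <= g x x + 2 * t * g x y + t ^+ 2 * g y y.
  have := ip_ge0 g (x + t *: y).
  rewrite ipDl !ipDr !ipZl !ipZr (ipC g y x); lra.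
(* The form may be degenerate. When [g y y = 0] the polynomial of [key] is affine in [t], and the
   value of [t] chosen below would make it equal to [-1] if [g x y] were non-zero. *)
have := ip_ge0 g y; rewrite le_eqVlt => /predU1P[y0|y0].
  rewrite -y0 mulr0; rewrite -y0 in key.
  have [->|xy0] := eqVneq (g x y) 0; first by rewrite expr0n.
  have := key (- (g x x + 1) / (2 * g x y)).
  rewrite (_ : 2 * _ * _ = - (g x x + 1)); last by field.
  by rewrite mulr0; lra.
have := key (- g x y / g y y).
rewrite (_ : _ + _ = (g x x * g y y - g x y ^+ 2) / g y y); last first.
  by field; rewrite gt_eqF.
by rewrite pmulr_lge0 ?invr_gt0 // subr_ge0.
Qed.

Lemma ip_le_nrm x y : g x y <= nrm x * nrm y.
Proof.
apply: le_trans (ler_norm _) _.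
rewrite -(@ler_pXn2r _ 2) ?nnegrE ?mulr_ge0 ?nrm_ge0 //.
by rewrite real_normK ?num_real // exprMn !sqr_nrm sqr_ip_le.
Qed.

Lemma nrmD x y : nrm (x + y) <= nrm x + nrm y.
Proof.
rewrite -(@ler_pXn2r _ 2) ?nnegrE ?addr_ge0 ?nrm_ge0 //.
rewrite sqrrD !sqr_nrm ipDl !ipDr (ipC g y x).
have := ip_le_nrm x y; lra.
Qed.

Lemma nrmZ a x : nrm (a *: x) = `|a| * nrm x.
Proof.
rewrite /nrm ipZl ipZr mulrA sqrtrM; first by rewrite -expr2 sqrtr_sqr.
by rewrite -expr2 sqr_ge0.
Qed.

Lemma nrmN x : nrm (- x) = nrm x.
Proof. by rewrite -scaleN1r nrmZ normrN1 mul1r. Qed.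

Lemma nrm0 : nrm 0 = 0.
Proof. by rewrite /nrm ip0l sqrtr0. Qed.

Lemma nrmBC x y : nrm (x - y) = nrm (y - x).
Proof. by rewrite -nrmN opprB. Qed.

Lemma nrm_sum (I : Type) (r : seq I) (P : pred I) (F : I -> H) :
  nrm (\sum_(i <- r | P i) F i) <= \sum_(i <- r | P i) nrm (F i).
Proof.
elim/big_rec2: _ => [|i u w _ uw]; first by rewrite nrm0.
by apply: le_trans (nrmD _ _) _; rewrite lerD2l.
Qed.

Lemma ip_le_mean x y : g x y <= (g x x + g y y) / 2.
Proof. have := ip_ge0 g (x - y); rewrite ipBl !ipBr (ipC g y x); lra. Qed.

End SemiNorm.

(** * Convex sets and finite means *)

Section Convex.
Context (R : realType) (H : lmodType R).

Definition convexP (V : H -> Prop) := forall (x y : H) (t : R),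
  0 <= t <= 1 -> V x -> V y -> V (t *: x + (1 - t) *: y).

Lemma convexP_mean (V : H -> Prop) (n : nat) (F : nat -> H) : convexP V ->
  (0 < n)%N -> (forall i, (i < n)%N -> V (F i)) ->
  V (n%:R^-1 *: \sum_(i < n) F i).
Proof.
move=> cV; case: n => // n _; elim: n => [|n IH] VF.
  by rewrite big_ord1 invr1 scale1r; exact: VF.
rewrite big_ord_recr /= scalerDr.
have -> : n.+2%:R^-1 *: \sum_(i < n.+1) F i =
    (n.+1%:R / n.+2%:R) *: (n.+1%:R^-1 *: \sum_(i < n.+1) F i) :> H.
  rewrite scalerA mulrAC divff ?mul1r //; by rewrite pnatr_eq0.
have E : n.+2%:R^-1 = 1 - n.+1%:R / n.+2%:R :> R.
  rewrite -[X in X - _](@divff _ n.+2%:R) ?pnatr_eq0 //.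
  by rewrite -mulrBl -natrB // subSnn mul1r.
rewrite [X in _ + X *: _]E; apply: cV; last by exact: VF.
  by rewrite divr_ge0 //= ler_pdivrMr ?ltr0n // mul1r ler_nat.
by apply: IH => i lin; apply: VF; rewrite (leq_trans lin).
Qed.

End Convex.

(** * Lattice shifts, slow variation and box averages *)

Record shift_action (R : realType) (H : lmodType R) (g : semi_inner H)
    (d : nat) := ShiftAction {
  tau :> 'rV[int]_d -> H -> H ;
  tauD : forall m x y, tau m (x + y) = tau m x + tau m y ;
  tauZ : forall m a x, tau m (a *: x) = a *: tau m x ;
  tau_add : forall m n x, tau (m + n) x = tau m (tau n x) ;
  tau0 : forall x, tau 0 x = x ;
  tau_ip : forall m x y, g (tau m x) (tau m y) = g x y }.

Section Shift.
Context (R : realType) (H : lmodType R) (g : semi_inner H) (d : nat).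
Context (s : shift_action g d).
Implicit Types (x y z W Z : H) (m q : 'rV[int]_d) (L : R).

Local Notation nrm := (nrm g).

Definition unitv (j : 'I_d) : 'rV[int]_d := delta_mx 0 j.

Definition abs1 q : nat := (\sum_j `|q ord0 j|)%N.

Lemma tau_z m : s m 0 = 0.
Proof. by rewrite -(scale0r 0) tauZ !scale0r. Qed.

Lemma tauN m x : s m (- x) = - s m x.
Proof. by rewrite -scaleN1r tauZ scaleN1r. Qed.

Lemma tauB m x y : s m (x - y) = s m x - s m y.
Proof. by rewrite tauD tauN. Qed.

Lemma tau_sum m (I : Type) (r : seq I) (P : pred I) (F : I -> H) :
  s m (\sum_(i <- r | P i) F i) = \sum_(i <- r | P i) s m (F i).
Proof. by elim/big_rec2: _ => [|i u w _ <-]; rewrite ?tau_z // tauD. Qed.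

Lemma tau_nrm m x : nrm (s m x) = nrm x.
Proof. by rewrite /nrm tau_ip. Qed.

Lemma tau_adj m x y : g x (s m y) = g (s (- m) x) y.
Proof. by rewrite -(tau_ip s (- m)) -tau_add addNr tau0. Qed.

(** Slow variation along the action, tested on unit steps only; [lip_tau] extends it to all
    displacements. *)
Definition lip L Z := forall j, nrm (s (unitv j) Z - Z) <= L.

Lemma nrm_tauD m q Z :
  nrm (s (m + q) Z - Z) <= nrm (s m Z - Z) + nrm (s q Z - Z).
Proof.
have -> : s (m + q) Z - Z = s m (s q Z - Z) + (s m Z - Z).
  by rewrite tau_add tauB subrKA.
by rewrite addrC (le_trans (nrmD _ _ _)) // tau_nrm addrC.
Qed.

Lemma nrm_tau_opp q Z : nrm (s (- q) Z - Z) = nrm (s q Z - Z).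
Proof. by rewrite -(tau_nrm q) tauB -tau_add subrr tau0 nrmBC. Qed.

Lemma nrm_tau_muln q Z k : nrm (s (q *+ k) Z - Z) <= k%:R * nrm (s q Z - Z).
Proof.
elim: k => [|k IH]; first by rewrite mulr0n tau0 subrr nrm0 mul0r.
rewrite mulrS (le_trans (nrm_tauD _ _ _)) // mulrS mulrDl mul1r.
by rewrite lerD2l.
Qed.

Lemma nrm_tau_mulz q Z (k : int) :
  nrm (s (q *~ k) Z - Z) <= `|k|%N%:R * nrm (s q Z - Z).
Proof.
case: k => k; first exact: nrm_tau_muln.
by rewrite NegzE mulrNz nrm_tau_opp abszN; exact: nrm_tau_muln.
Qed.

(** The vector [q] is reached by [abs1 q] unit steps along the axes, and each step costs at most [L]
    because the action is isometric. *)
Lemma lip_tau L Z q : 0 <= L -> lip L Z -> nrm (s q Z - Z) <= (abs1 q)%:R * L.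
Proof.
move=> L0 ZL; rewrite {1}(row_sum_delta q) /abs1 natr_sum mulr_suml.
elim/big_rec2: _ => [|j u v _ vu]; first by rewrite tau0 subrr nrm0.
rewrite (le_trans (nrm_tauD _ _ _)) // lerD //.
rewrite -[q 0 j]intz scaler_int (le_trans (nrm_tau_mulz _ _ _)) //.
by rewrite intz ler_wpM2l // ZL.
Qed.

Definition avg b (j : 'I_d) x : H :=
  b%:R^-1 *: \sum_(i < b) s (unitv j *+ i) x.

Lemma tau_avg m b j x : s m (avg b j x) = avg b j (s m x).
Proof.
rewrite /avg tauZ tau_sum; congr (_ *: _); apply: eq_bigr => i _.
by rewrite -!tau_add addrC.
Qed.

Lemma avgB b j x y : avg b j (x - y) = avg b j x - avg b j y.
Proof.
rewrite /avg -scalerBr -sumrB; congr (_ *: _); apply: eq_bigr => i _.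
by rewrite tauB.
Qed.

Lemma nrm_avg b j x : (0 < b)%N -> nrm (avg b j x) <= nrm x.
Proof.
move=> b0; rewrite /avg nrmZ ger0_norm ?invr_ge0 ?ler0n //.
rewrite ler_pdivrMl ?ltr0n // (le_trans (nrm_sum _ _ _ _)) //.
under eq_bigr do rewrite tau_nrm.
by rewrite sumr_const card_ord mulr_natl.
Qed.

(** The difference telescopes: out of [b] terms only the two boundary ones remain. *)
Lemma nrm_tau_avg b j x : (0 < b)%N ->
  nrm (s (unitv j) (avg b j x) - avg b j x) <= 2 / b%:R * nrm x.
Proof.
move=> b0; rewrite tau_avg -avgB.
have -> : avg b j (s (unitv j) x - x) =
    b%:R^-1 *: (s (unitv j *+ b) x - x).
  congr (_ *: _); rewrite (eq_bigr (fun i : 'I_b =>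
    s (unitv j *+ i.+1) x - s (unitv j *+ i) x)); last first.
    by move=> i _; rewrite tauB -tau_add -mulrSr.
  rewrite -(big_mkord xpredT
    (fun i => s (unitv j *+ i.+1) x - s (unitv j *+ i) x)).
  by rewrite telescope_sumr // mulr0n tau0.
rewrite nrmZ ger0_norm ?invr_ge0 ?ler0n // mulrAC -[2 * _ / _]mulrC.
rewrite ler_wpM2l ?invr_ge0 ?ler0n // (le_trans (nrmD _ _ _)) //.
by rewrite nrmN tau_nrm; lra.
Qed.

(** When [l] lists all the coordinates, this is the average over the translations by the box of side
    [b]. Composing one-dimensional averages keeps the telescoping available in every direction. *)
Definition smooth b (l : seq 'I_d) x : H := foldr (avg b) x l.

Lemma nrm_smooth b l x : (0 < b)%N -> nrm (smooth b l x) <= nrm x.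
Proof.
by move=> b0; elim: l => //= j l IH; exact: le_trans (nrm_avg _ _ _) IH.
Qed.

Lemma lip_smooth b l x j : (0 < b)%N -> j \in l ->
  nrm (s (unitv j) (smooth b l x) - smooth b l x) <= 2 / b%:R * nrm x.
Proof.
move=> b0; elim: l => //= k l IH; rewrite inE => /orP[/eqP<-|/IH{}IH].
  rewrite (le_trans (nrm_tau_avg _ _ _)) // ler_wpM2l ?divr_ge0 ?ler0n //.
  exact: nrm_smooth.
by rewrite tau_avg -avgB (le_trans (nrm_avg _ _ _)).
Qed.

Definition box b q := forall j, 0 <= q ord0 j < b%:Z.

Lemma convexP_tau (V : H -> Prop) m : convexP V -> convexP (fun x => V (s m x)).
Proof. by move=> cV x y t t01 Vx Vy; rewrite tauD !tauZ; exact: cV. Qed.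

(** The condition that [q] vanishes outside [l] lets the induction fill one coordinate at a time.
    The set [V] is generalized because the translation of the outermost average is absorbed into
    it. *)
Lemma smooth_mem_seq (V : H -> Prop) b l x : convexP V -> (0 < b)%N -> uniq l ->
  (forall q, box b q -> (forall j, j \notin l -> q ord0 j = 0) -> V (s q x)) ->
  V (smooth b l x).
Proof.
move=> + b0; elim: l V => [|k l IH] V cV /= ul Vx.
  rewrite -(tau0 s x); apply: Vx => [j|j _]; rewrite mxE //.
case/andP: ul => kl ul.
apply: (@convexP_mean _ _ V b (fun i => s (unitv k *+ i) (smooth b l x)) cV b0)
  => i ib.
apply: (IH (fun y => V (s (unitv k *+ i) y))) => //; first exact: convexP_tau.
move=> q bq ql; rewrite -tau_add.
have E j : (unitv k *+ i + q) ord0 j = if j == k then i%:Z else q ord0 j.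
  rewrite mxE mulmxnE mxE eqxx /=.
  have [->|jk] := eqVneq j k; first by rewrite (ql _ kl) addr0 -[RHS]natz.
  by rewrite mul0rn add0r.
apply: Vx => j; rewrite E.
  by case: eqP => // _; rewrite lez_nat ltz_nat ib.
by rewrite inE negb_or => /andP[/negbTE-> /ql].
Qed.

Lemma smooth_mem (V : H -> Prop) b x : convexP V -> (0 < b)%N ->
  (forall q, box b q -> V (s q x)) -> V (smooth b (enum 'I_d) x).
Proof.
move=> cV b0 Vx; apply: smooth_mem_seq => //; first exact: enum_uniq.
by move=> q bq _; exact: Vx.
Qed.

Lemma abs1D q m : (abs1 (q + m) <= abs1 q + abs1 m)%N.
Proof.
rewrite /abs1 -big_split /= leq_sum // => j _; rewrite mxE.
by rewrite -lez_nat PoszD !abszE ler_normD.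
Qed.

Lemma abs1N q : abs1 (- q) = abs1 q.
Proof. by apply: eq_bigr => j _; rewrite mxE abszN. Qed.

Lemma abs1_muln q k : (abs1 (q *+ k) <= abs1 q * k)%N.
Proof.
elim: k => [|k IH]; first by rewrite mulr0n /abs1 big1 // => j _; rewrite mxE.
by rewrite mulrS (leq_trans (abs1D _ _)) // mulnS leq_add2l.
Qed.

Lemma abs1_box b q : box b q -> (abs1 q <= d * b)%N.
Proof.
move=> bq; rewrite -[d in (d * b)%N]card_ord -sum_nat_const leq_sum // => j _.
by have /andP[] := bq j; case: (q _ _) => // k _; rewrite ltz_nat => /ltnW.
Qed.

End Shift.

(** * The Banach-Saks combination over separated scales *)

Section BanachSaks.
Context (R : realType) (H : lmodType R) (g : semi_inner H) (d : nat).
Context (s : shift_action g d) (I : finType).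
Variables (v : I -> H) (e : I -> 'rV[int]_d) (V : H -> Prop).
Variables (E B t : R) (gu a p : nat).
Hypothesis V_convex : convexP V.
Hypothesis e_le1 : forall i, (abs1 (e i) <= 1)%N.
Hypothesis E_ge0 : 0 <= E.
Hypothesis v_le : g (\sum_i v i) (\sum_i v i) <= E.
Hypothesis sum_v_le : \sum_i nrm g (v i) <= B * Num.sqrt E.
Hypothesis t01 : 0 <= t <= 1.
Hypotheses (a_gt0 : (0 < a)%N) (p_gt0 : (0 < p)%N).

(* [X b q] is [\sum_i v i] with its terms displaced by about [gu * b], and [W b]
   is the average of the [X b q] over the box of side [b]. *)
Let X b q : H := \sum_i s (q - e i *+ (gu * b)) (v i).
Let W b : H := smooth s b (enum 'I_d) (X b 0).
Let err : R := (gu + d)%:R * (2 * B ^+ 2 / p%:R).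

Hypothesis B_ge0 : 0 <= B.

Lemma X_tau b q : s q (X b 0) = X b q.
Proof. by rewrite tau_sum; apply: eq_bigr => i _; rewrite -tau_add add0r. Qed.

Lemma nrm_X b q : nrm g (X b q) <= B * Num.sqrt E.
Proof.
apply: le_trans sum_v_le; apply: le_trans (nrm_sum _ _ _ _) _.
by apply: ler_sum => i _; rewrite tau_nrm.
Qed.

Lemma ip_W b : (0 < b)%N -> g (W b) (W b) <= B ^+ 2 * E.
Proof.
move=> b0; rewrite -sqr_nrm -(sqr_sqrtr E_ge0) -exprMn.
rewrite ler_pXn2r ?nnegrE ?nrm_ge0 ?mulr_ge0 ?sqrtr_ge0 //.
exact: le_trans (nrm_smooth _ _ _ b0) (nrm_X _ _).
Qed.

Lemma lip_W b : (0 < b)%N -> lip s (2 / b%:R * (B * Num.sqrt E)) (W b).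
Proof.
move=> b0 j; apply: le_trans (lip_smooth _ _ b0 _) _; first by rewrite mem_enum.
by rewrite ler_wpM2l ?divr_ge0 ?ler0n // nrm_X.
Qed.

(* Translating [v i] by at most [(gu + d) * b] is invisible to a vector which
   varies at the scale [p * b]. *)
Lemma ip_X_le b q Z : (0 < b)%N -> box b q ->
  lip s (2 / (p * b)%:R * (B * Num.sqrt E)) Z ->
  g Z (X b q) <= g Z (\sum_i v i) + err * E.
Proof.
move=> b0 bq; set L := 2 / _ * _ => LZ.
have L0 : 0 <= L.
  by rewrite mulr_ge0 ?divr_ge0 ?ler0n // mulr_ge0 ?sqrtr_ge0.
rewrite !ip_sumr; apply: (@le_trans _ _
  (\sum_i (g Z (v i) + ((gu + d) * b)%:R * L * nrm g (v i)))).
  apply: ler_sum => i _; rewrite tau_adj -lerBlDl -ipBl.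
  apply: le_trans (ip_le_nrm _ _ _) _; rewrite ler_wpM2r ?nrm_ge0 //.
  apply: le_trans (lip_tau _ L0 LZ) _; rewrite ler_wpM2r // ler_nat abs1N.
  apply: leq_trans (abs1D _ _) _; rewrite abs1N mulnDl addnC leq_add //.
    apply: leq_trans (abs1_muln _ _) _.
    by rewrite -[leqRHS]mul1n leq_mul2r e_le1 orbT.
  exact: abs1_box.
rewrite big_split /= lerD2l -mulr_sumr.
apply: le_trans (ler_wpM2l _ sum_v_le) _; first by rewrite mulr_ge0 ?ler0n.
rewrite /L /err !natrM -[in leRHS](sqr_sqrtr E_ge0).
rewrite le_eqVlt; apply/orP; left; apply/eqP.
by field; rewrite !pnatr_eq0 -!lt0n b0 p_gt0.
Qed.

(** An upper bound on the inner product with [Z] defines a convex set, so it passes from the [X b q]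
    to their average over the box. *)
Lemma ip_W_le b Z : (0 < b)%N ->
  lip s (2 / (p * b)%:R * (B * Num.sqrt E)) Z ->
  g Z (W b) <= g Z (\sum_i v i) + err * E.
Proof.
move=> b0 LZ; apply: (@smooth_mem _ _ _ _ s
  (fun x => g Z x <= g Z (\sum_i v i) + err * E)) => //; last first.
  by move=> q bq; rewrite X_tau; exact: ip_X_le.
move=> x y u /andP[u0 u1]; rewrite ipDr !ipZr; set c := _ + _ => xc yc.
have -> : c = u * c + (1 - u) * c by ring.
by rewrite lerD // ler_wpM2l // subr_ge0.
Qed.

Variable N : nat.
Hypothesis V_X : forall n q, (n <= N)%N -> box (a * p ^ n) q ->
  V (X (a * p ^ n) q).

Lemma V_W n : (n <= N)%N -> V (W (a * p ^ n)).
Proof.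
move=> nN; apply: smooth_mem => //; first by rewrite muln_gt0 a_gt0 expn_gt0 p_gt0.
by move=> q bq; rewrite X_tau; exact: V_X.
Qed.

(** Scales are added from [a * p ^ N] downwards, the new one with weight [t]. The combination built
    so far varies slowly at the next scale, so its inner product with the new [W b] is almost that
    with the sum of the [v i]. Each step multiplies the excess of [g Z Z] over [E] by about [1 - t],
    at a cost of order [t ^+ 2], up to the [err] term. *)
Lemma banach_saks_ind n : (n <= N)%N -> exists Z, [/\ V Z,
  lip s (2 / (a * p ^ (N - n))%:R * (B * Num.sqrt E)) Z &
  g Z Z <= (1 + 2 * err + t * B ^+ 2 + (1 - t) ^+ n * B ^+ 2) * E].
Proof.
have err0 : 0 <= err by rewrite mulr_ge0 ?ler0n // divr_ge0 ?ler0n // mulr_ge0 ?sqr_ge0.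
have ap0 k : (0 < a * p ^ k)%N by rewrite muln_gt0 a_gt0 expn_gt0 p_gt0.
have /andP[t0 t1] := t01.
elim: n => [|n IH] nN.
  exists (W (a * p ^ N)); rewrite subn0; split; [exact: V_W|exact: lip_W|].
  rewrite expr0 mul1r (le_trans (ip_W _)) // ler_wpM2r //.
  by rewrite lerDr addr_ge0 // ?mulr_ge0 ?sqr_ge0 //; lra.
have [Z [VZ LZ gZ]] := IH (ltnW nN).
set b := (a * p ^ (N - n.+1))%N.
have bE : (a * p ^ (N - n) = p * b)%N by rewrite /b mulnCA -expnS -subSn.
rewrite bE in LZ.
exists (t *: W b + (1 - t) *: Z); split.
- by apply: V_convex => //; apply: V_W; rewrite leq_subr.
- move=> j; rewrite tauD !tauZ opprD addrACA -!scalerBr.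
  apply: le_trans (nrmD _ _ _) _; rewrite !nrmZ !ger0_norm ?subr_ge0 //.
  set L := 2 / _ * _; have -> : L = t * L + (1 - t) * L by ring.
  apply: lerD; rewrite ler_wpM2l ?subr_ge0 //.
    by apply: lip_W => //; exact: ap0.
  apply: le_trans (LZ j) _; rewrite ler_wpM2r ?mulr_ge0 ?sqrtr_ge0 //.
  rewrite ler_wpM2l // lef_pV2 ?posrE ?ltr0n ?muln_gt0 ?p_gt0 ?a_gt0 ?expn_gt0 ?p_gt0 //.
  by rewrite ler_nat leq_pmull.
(* The arithmetic mean, rather than the product of the norms, keeps the recursion linear in [g Z Z]:
   its total coefficient is [(1 - t) ^+ 2 + t * (1 - t) = 1 - t]. *)
have gZW : g Z (W b) <= (g Z Z + E) / 2 + err * E.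
  apply: le_trans (ip_W_le (ap0 _) LZ) _; rewrite lerD2r.
  by apply: le_trans (ip_le_mean _ _ _) _; rewrite ler_pM2r ?invr_gt0 // lerD2l.
have gW : g (W b) (W b) <= B ^+ 2 * E by apply: ip_W; exact: ap0.
rewrite ipDl !ipDr !ipZl !ipZr (ipC g (W b) Z) [(1 - t) ^+ n.+1]exprS.
set z := g Z Z in gZ gZW *; set y := g Z (W b) in gZW *.
set w := g (W b) (W b) in gW *; set D := B ^+ 2 in gZ gW err0 *.
set P := (1 - t) ^+ n in gZ *.
have h1 : 2 * t * (1 - t) * y <= 2 * t * (1 - t) * ((z + E) / 2 + err * E).
  by rewrite ler_wpM2l // mulr_ge0 ?subr_ge0 // mulr_ge0.
have h2 : t ^+ 2 * w <= t ^+ 2 * (D * E) by rewrite ler_wpM2l ?sqr_ge0.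
have h3 : (1 - t) * z <= (1 - t) * ((1 + 2 * err + t * D + P * D) * E).
  by rewrite ler_wpM2l ?subr_ge0.
have h4 : 0 <= t ^+ 2 * (E + 2 * err * E).
  by rewrite mulr_ge0 ?sqr_ge0 // addr_ge0 // mulr_ge0 // mulr_ge0.
lra.
Qed.

Lemma banach_saks : exists2 Z, V Z &
  g Z Z <= (1 + 2 * err + t * B ^+ 2 + (1 - t) ^+ N * B ^+ 2) * E.
Proof. by have [Z [VZ _ gZ]] := banach_saks_ind (leqnn N); exists Z. Qed.

End BanachSaks.

(** * Transforms of measures *)

Section BoundedMeasurable.
Context dT (T : measurableType dT) (R : realType).

Definition bounded_measurable (f : T -> R) :=
  measurable_fun setT f /\ exists M, forall x, `|f x| <= M.

Lemma bounded_measurable_cst (a : R) : bounded_measurable (fun=> a).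
Proof. by split; [exact: measurable_cst|exists `|a|]. Qed.

Lemma bounded_measurableD (f h : T -> R) : bounded_measurable f ->
  bounded_measurable h -> bounded_measurable (fun x => f x + h x).
Proof.
move=> [mf [M fM]] [mh [N hN]]; split; first exact: measurable_funD.
by exists (M + N) => x; rewrite (le_trans (ler_normD _ _)) // lerD.
Qed.

Lemma bounded_measurableM (f h : T -> R) : bounded_measurable f ->
  bounded_measurable h -> bounded_measurable (fun x => f x * h x).
Proof.
move=> [mf [M fM]] [mh [N hN]]; split; first exact: measurable_funM.
by exists (M * N) => x; rewrite normrM ler_pM.
Qed.

Lemma bounded_measurableB (f h : T -> R) : bounded_measurable f ->
  bounded_measurable h -> bounded_measurable (fun x => f x - h x).
Proof.
move=> [mf [M fM]] [mh [N hN]]; split; first exact: measurable_funB.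
by exists (M + N) => x; rewrite (le_trans (ler_normB _ _)) // lerD.
Qed.

Lemma bounded_measurable_sum (I : Type) (r : seq I) (P : pred I)
    (F : I -> T -> R) : (forall i, bounded_measurable (F i)) ->
  bounded_measurable (fun x => \sum_(i <- r | P i) F i x).
Proof.
move=> bF; elim: r => [|i r IH].
  under eq_fun do rewrite big_nil; exact: bounded_measurable_cst.
under eq_fun do rewrite big_cons.
by case: (P i) => //; exact: bounded_measurableD.
Qed.

Lemma bounded_measurable_indic (A : set T) : measurable A ->
  bounded_measurable (\1_A : T -> R).
Proof.
move=> mA; split; first exact: measurable_indic.
by exists 1 => x; rewrite indicE; case: (_ \in _); rewrite ?normr1 ?normr0.
Qed.

Lemma bounded_measurable_integrable
    (mu : {finite_measure set T -> \bar R}) (A : set T) f :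
  measurable A -> bounded_measurable f -> mu.-integrable A (EFin \o f).
Proof.
move=> mA [mf [M fM]]; apply: measurable_bounded_integrable => //.
- by rewrite -ge0_fin_numE // fin_num_measure.
- exact: measurable_funTS.
- exists M; split; first by rewrite num_real.
  by move=> y My x _ /=; rewrite (le_trans (fM x)) // ltW.
Qed.

Definition bm : {pred (T -> R^o)} := fun f => `[< bounded_measurable f >].

Lemma bm_submod_closed : submod_closed bm.
Proof.
split; first exact/asboolP/bounded_measurable_cst.
move=> a f h /asboolP bf /asboolP bh; apply/asboolP.
apply: (@bounded_measurableD (fun x => a * f x)) => //.
exact: (@bounded_measurableM (fun=> a)) (bounded_measurable_cst a) bf.
Qed.

HB.instance Definition _ := GRing.isSubmodClosed.Build _ _ bm bm_submod_closed.

(** Bundling makes these functions a module, so that pairs of them can carry the abstract form. They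
    are kept pointwise, not modulo null sets, which is why the form is only semi-definite. *)
Record bmf := BMF { bmf_fun :> T -> R^o ; bmf_in : bmf_fun \in bm }.

HB.instance Definition _ := [isSub for bmf_fun].
HB.instance Definition _ := [Choice of bmf by <:].
HB.instance Definition _ := [SubChoice_isSubLmodule of bmf by <:].

Lemma bmfP (f : bmf) : bounded_measurable f.
Proof. by case: f => f /= /asboolP. Qed.

Definition bmf_of (f : T -> R) (bf : bounded_measurable f) : bmf :=
  BMF (introT (asboolP (bounded_measurable f)) bf).

Lemma bmf_eq (f h : bmf) : (forall x, f x = h x) -> f = h.
Proof. by move=> fh; apply/val_inj/funext. Qed.

Lemma bmfDE (f h : bmf) x : (f + h) x = f x + h x.
Proof. by []. Qed.

Lemma bmfZE a (f : bmf) x : (a *: f) x = a * f x.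
Proof. by []. Qed.

End BoundedMeasurable.

Lemma bounded_measurable_comp dT (T : measurableType dT) dU
    (U : measurableType dU) (R : realType) (F : U -> T) (f : T -> R) :
  measurable_fun setT F -> bounded_measurable f ->
  bounded_measurable (fun x => f (F x)).
Proof.
by move=> mF [mf [M fM]]; split; [exact: measurableT_comp|exists M].
Qed.

Section Form.
Context dT (T : measurableType dT) (R : realType).
Variable mu : {finite_measure set T -> \bar R}.

Lemma bounded_measurable_integrableT f : bounded_measurable f ->
  mu.-integrable setT (EFin \o f).
Proof. exact: bounded_measurable_integrable. Qed.

Lemma RintegralD_bm f h : bounded_measurable f -> bounded_measurable h ->
  \int[mu]_x (f x + h x) = \int[mu]_x f x + \int[mu]_x h x.
Proof. by move=> bf bh; rewrite RintegralD //; exact: bounded_measurable_integrableT. Qed.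

Lemma RintegralZ_bm a f : bounded_measurable f ->
  \int[mu]_x (a * f x) = a * \int[mu]_x f x.
Proof. by move=> bf; rewrite RintegralZl //; exact: bounded_measurable_integrableT. Qed.

Lemma Rintegral_sum_bm (I : Type) (r : seq I) (P : pred I) (F : I -> T -> R) :
  (forall i, bounded_measurable (F i)) ->
  \int[mu]_x (\sum_(i <- r | P i) F i x) = \sum_(i <- r | P i) \int[mu]_x F i x.
Proof.
move=> bF; elim: r => [|i r IH].
  under eq_Rintegral do rewrite big_nil.
  by rewrite big_nil Rintegral_cst // mul0r.
under eq_Rintegral do rewrite big_cons.
rewrite big_cons; case: (P i) => //.
by rewrite RintegralD_bm ?IH //; exact: bounded_measurable_sum.
Qed.

Lemma le_Rintegral_bm f h : bounded_measurable f -> bounded_measurable h ->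
  (forall x, f x <= h x) -> \int[mu]_x f x <= \int[mu]_x h x.
Proof.
by move=> bf bh fh; apply: le_Rintegral => //; exact: bounded_measurable_integrableT.
Qed.

Local Notation H := (bmf T R * bmf T R)%type.

(** The real part of the [L^2(mu)] inner product, a pair standing for the complex function
    [u.1 + i u.2]. *)
Definition pair_ip (u v : H) : R := \int[mu]_x (u.1 x * v.1 x + u.2 x * v.2 x).

Lemma bm_pair (u v : H) :
  bounded_measurable (fun x => u.1 x * v.1 x + u.2 x * v.2 x).
Proof.
by apply: bounded_measurableD; apply: bounded_measurableM; exact: bmfP.
Qed.

Lemma pair_ipC u v : pair_ip u v = pair_ip v u.
Proof. by apply: eq_Rintegral => x _; congr (_ + _); rewrite mulrC. Qed.

Lemma pair_ipDl u v w : pair_ip (u + v) w = pair_ip u w + pair_ip v w.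
Proof.
rewrite /pair_ip -RintegralD_bm; [|exact: bm_pair..].
by apply: eq_Rintegral => x _; rewrite !bmfDE; ring.
Qed.

Lemma pair_ipZl a u v : pair_ip (a *: u) v = a * pair_ip u v.
Proof.
rewrite /pair_ip -RintegralZ_bm; last exact: bm_pair.
by apply: eq_Rintegral => x _; rewrite !bmfZE; ring.
Qed.

Lemma pair_ip_ge0 u : 0 <= pair_ip u u.
Proof.
by apply: Rintegral_ge0 => x _; rewrite -!expr2 addr_ge0 // sqr_ge0.
Qed.

Definition pair_form : semi_inner H :=
  SemiInner pair_ipC pair_ipDl pair_ipZl pair_ip_ge0.

Section Rotation.
Variables (d : nat) (c s : 'rV[int]_d -> T -> R).
Hypothesis bc : forall m, bounded_measurable (c m).
Hypothesis bs : forall m, bounded_measurable (s m).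
Hypothesis cD : forall m n x, c (m + n) x = c m x * c n x - s m x * s n x.
Hypothesis sD : forall m n x, s (m + n) x = s m x * c n x + c m x * s n x.
Hypothesis cs1 : forall m x, c m x ^+ 2 + s m x ^+ 2 = 1.
Hypothesis c0 : forall x, c 0 x = 1.
Hypothesis s0 : forall x, s 0 x = 0.

(** Multiplication of [u.1 + i u.2] by the unimodular function [c m + i s m]. *)
Definition rotation m (u : H) : H :=
  (bmf_of (bounded_measurableB (bounded_measurableM (bc m) (bmfP u.1))
                               (bounded_measurableM (bs m) (bmfP u.2))),
   bmf_of (bounded_measurableD (bounded_measurableM (bs m) (bmfP u.1))
                               (bounded_measurableM (bc m) (bmfP u.2)))).

Lemma rotation1E m u x : (rotation m u).1 x = c m x * u.1 x - s m x * u.2 x.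
Proof. by []. Qed.

Lemma rotation2E m u x : (rotation m u).2 x = s m x * u.1 x + c m x * u.2 x.
Proof. by []. Qed.

Lemma pair_eq (u v : H) : (forall x, u.1 x = v.1 x) ->
  (forall x, u.2 x = v.2 x) -> u = v.
Proof. by case: u v => [a b] [a' b'] /= aa bb; congr (_, _); exact: bmf_eq. Qed.

Lemma rotationD m u v : rotation m (u + v) = rotation m u + rotation m v.
Proof.
apply: pair_eq => x; rewrite [in RHS]bmfDE;
  rewrite !(rotation1E, rotation2E) !bmfDE; ring.
Qed.

Lemma rotationZ m a u : rotation m (a *: u) = a *: rotation m u.
Proof.
apply: pair_eq => x; rewrite [in RHS]bmfZE;
  rewrite !(rotation1E, rotation2E) !bmfZE; ring.
Qed.

Lemma rotation_add m n u : rotation (m + n) u = rotation m (rotation n u).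
Proof.
by apply: pair_eq => x; rewrite !(rotation1E, rotation2E) cD sD; ring.
Qed.

Lemma rotation0 u : rotation 0 u = u.
Proof.
by apply: pair_eq => x; rewrite !(rotation1E, rotation2E) c0 s0; ring.
Qed.

Lemma rotation_ip m u v :
  pair_form (rotation m u) (rotation m v) = pair_form u v.
Proof.
apply: eq_Rintegral => x _; rewrite !(rotation1E, rotation2E).
set p := u.1 x; set q := u.2 x; set p' := v.1 x; set q' := v.2 x.
transitivity ((c m x ^+ 2 + s m x ^+ 2) * (p * p' + q * q')); first by ring.
by rewrite cs1 mul1r.
Qed.

Definition rotation_action : shift_action pair_form d :=
  ShiftAction rotationD rotationZ rotation_add rotation0 rotation_ip.

End Rotation.

End Form.

Section Fubini.
Context dT (T : measurableType dT) dX (X : measurableType dX) (R : realType).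
Variable mu : {finite_measure set T -> \bar R}.
Variable rho : {finite_measure set X -> \bar R}.
Variable f : T * X -> R.
Hypothesis bf : bounded_measurable f.

Lemma bm_section1 t : bounded_measurable (fun x => f (t, x)).
Proof. by apply: (bounded_measurable_comp _ bf). Qed.

Lemma bm_section2 x : bounded_measurable (fun t => f (t, x)).
Proof. by apply: (bounded_measurable_comp _ bf). Qed.

Let mf : measurable_fun setT (EFin \o f).
Proof. by apply/measurable_EFinP; case: bf. Qed.

Lemma bm_integrable12 : (mu \x rho)%E.-integrable setT (EFin \o f).
Proof.
apply/integrable12ltyP => //; have [_ [M fM]] := bf.
apply: (@le_lt_trans _ _ (\int[mu]_x (\int[rho]_y (cst M%:E) y))%E).
  apply: ge0_le_integral => //=.
  - by move=> *; exact: integral_ge0.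
  - apply: (measurable_fun_fubini_tonelli_F (abse \o (EFin \o f))) => //=.
    exact: measurableT_comp.
  - by move=> x _; apply: ge0_le_integral => //=;
      [do 2 apply: measurableT_comp => //; exact: (bm_section1 x).1
      |move=> y _; rewrite lee_fin].
rewrite (eq_integral (cst (M%:E * rho setT)%E)); last first.
  by move=> x _; rewrite integral_cst.
rewrite integral_cst //.
by rewrite ltey_eq !fin_numM ?fin_num_measure.
Qed.

Lemma Rintegral_fubini :
  \int[mu]_t \int[rho]_x f (t, x) = \int[rho]_x \int[mu]_t f (t, x).
Proof.
rewrite /Rintegral; congr fine.
transitivity (\int[mu]_t \int[rho]_x (f (t, x))%:E)%E.
  apply: eq_integral => t _; rewrite fineK //.
  exact: integrable_fin_num (bounded_measurable_integrableT _ (bm_section1 t)).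
rewrite (Fubini bm_integrable12); apply: eq_integral => x _; rewrite fineK //.
exact: integrable_fin_num (bounded_measurable_integrableT _ (bm_section2 x)).
Qed.

End Fubini.

Lemma bm_Rintegral1 dT (T : measurableType dT) dX (X : measurableType dX)
    (R : realType) (rho : {finite_measure set X -> \bar R}) (f : T * X -> R) :
  bounded_measurable f -> bounded_measurable (fun t => \int[rho]_x f (t, x)).
Proof.
move=> bf.
split.
  apply: measurableT_comp => //.
  (* Measurability of the partial integral does not involve the measure on [T], so any finite one,
     here [mzero], can be supplied. *)
  exact: (measurable_fubini_F (bm_integrable12 mzero rho bf)).
have [_ [M fM]] := bf.
exists (\int[rho]_x (cst M) x) => t.
apply: le_trans (le_normr_Rintegral _ _) _ => //.
  exact: bounded_measurable_integrableT (bm_section1 bf t).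
apply: le_Rintegral_bm => //; last exact: bounded_measurable_cst.
have [m [N fN]] := bm_section1 bf t; split; first exact: measurableT_comp.
by exists N => x; rewrite normr_id.
Qed.

(** * Vector fields over the positions and their integrals *)

Section Fields.
Context dT (T : measurableType dT) dX (X : measurableType dX) (R : realType).

Local Notation H := (bmf T R * bmf T R)%type.

(** A map from positions to [H], stored as a pair of jointly measurable functions so that Fubini
    applies: [sec] evaluates it at a position and [fint] integrates it over positions. *)
Definition field : Type := (bmf (T * X)%type R * bmf (T * X)%type R)%type.

Definition sec (F : field) (x : X) : H :=
  (bmf_of (bm_section2 (bmfP F.1) x), bmf_of (bm_section2 (bmfP F.2) x)).

Definition fint (rho : {finite_measure set X -> \bar R}) (F : field) : H :=
  (bmf_of (bm_Rintegral1 rho (bmfP F.1)), bmf_of (bm_Rintegral1 rho (bmfP F.2))).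

Implicit Types (F : field) (u : H) (x : X) (t : T)
  (rho : {finite_measure set X -> \bar R}).

Lemma sec_eq F x u : (forall t, F.1 (t, x) = u.1 t) ->
  (forall t, F.2 (t, x) = u.2 t) -> sec F x = u.
Proof. by move=> h1 h2; apply: pair_eq. Qed.

Lemma fint_eq rho F u : (forall t, \int[rho]_x F.1 (t, x) = u.1 t) ->
  (forall t, \int[rho]_x F.2 (t, x) = u.2 t) -> fint rho F = u.
Proof. by move=> h1 h2; apply: pair_eq. Qed.

Lemma sec_ext F F' : (forall x, sec F x = sec F' x) -> F = F'.
Proof.
move=> FF'; have E x t : F.1 (t, x) = F'.1 (t, x) /\ F.2 (t, x) = F'.2 (t, x).
  by split; [have /(congr1 (fun u : H => u.1 t)) := FF' x
            |have /(congr1 (fun u : H => u.2 t)) := FF' x].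
by apply: pair_eq => -[t x]; have [] := E x t.
Qed.

Lemma secD F F' x : sec (F + F') x = sec F x + sec F' x.
Proof. exact: sec_eq. Qed.

Lemma secZ a F x : sec (a *: F) x = a *: sec F x.
Proof. exact: sec_eq. Qed.

Lemma sec0 x : sec 0 x = 0.
Proof. by rewrite -[in LHS](scale0r 0) secZ scale0r. Qed.

Lemma sec_sum (I : Type) (r : seq I) (P : pred I) (F : I -> field) x :
  sec (\sum_(i <- r | P i) F i) x = \sum_(i <- r | P i) sec (F i) x.
Proof. by elim/big_rec2: _ => [|i u w _ <-]; rewrite ?sec0 // secD. Qed.

Lemma fintD rho F F' : fint rho (F + F') = fint rho F + fint rho F'.
Proof.
by apply: fint_eq => t; rewrite [RHS]bmfDE -RintegralD_bm //;
  exact: bm_section1 (bmfP _) _.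
Qed.

Lemma fintZ rho a F : fint rho (a *: F) = a *: fint rho F.
Proof.
by apply: fint_eq => t; rewrite [RHS]bmfZE -RintegralZ_bm //;
  exact: bm_section1 (bmfP _) _.
Qed.

Lemma fint0 rho : fint rho 0 = 0.
Proof. by rewrite -[in LHS](scale0r 0) fintZ scale0r. Qed.

Lemma fint_sum rho (I : Type) (r : seq I) (P : pred I) (F : I -> field) :
  fint rho (\sum_(i <- r | P i) F i) = \sum_(i <- r | P i) fint rho (F i).
Proof. by elim/big_rec2: _ => [|i u w _ <-]; rewrite ?fint0 // fintD. Qed.

Lemma bounded_measurable_comp2 (f : bmf (T * X)%type R) (phi : X -> X) :
  measurable_fun setT phi ->
  bounded_measurable (fun z : T * X => f (z.1, phi z.2)).
Proof.
move=> mphi; apply: (bounded_measurable_comp _ (bmfP f)).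
apply/measurable_fun_pairP; split => /=; first exact: measurable_fst.
exact: (measurableT_comp mphi measurable_snd).
Qed.

Definition comp_field (phi : X -> X) (mphi : measurable_fun setT phi)
    (F : field) : field :=
  (bmf_of (bounded_measurable_comp2 F.1 mphi),
   bmf_of (bounded_measurable_comp2 F.2 mphi)).

Lemma sec_comp phi mphi F x : sec (@comp_field phi mphi F) x = sec F (phi x).
Proof. exact: sec_eq. Qed.

Lemma bounded_measurable_loc (f : bmf (T * X)%type R) (A : set X) :
  measurable A -> bounded_measurable (fun z : T * X => \1_A z.2 * f z).
Proof.
move=> mA; apply: bounded_measurableM; last exact: bmfP.
exact: bounded_measurable_comp (measurable_snd) (bounded_measurable_indic R mA).
Qed.

Definition loc_field (A : set X) (mA : measurable A) (F : field) : field :=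
  (bmf_of (bounded_measurable_loc F.1 mA),
   bmf_of (bounded_measurable_loc F.2 mA)).

Lemma sec_loc A mA F x : sec (@loc_field A mA F) x = (\1_A x : R) *: sec F x.
Proof. exact: sec_eq. Qed.

Section Mu.
Variable mu : {finite_measure set T -> \bar R}.

Local Notation g := (pair_form mu).

Lemma bm_pair_sec F u : bounded_measurable
  (fun z : T * X => F.1 z * u.1 z.1 + F.2 z * u.2 z.1).
Proof.
by apply: bounded_measurableD; apply: bounded_measurableM; try exact: bmfP;
  exact: bounded_measurable_comp (measurable_fst) (bmfP _).
Qed.

Lemma bm_ip_sec F u : bounded_measurable (fun x => g (sec F x) u).
Proof.
apply: (@bm_Rintegral1 _ X _ T R mu
  (fun z => F.1 (z.2, z.1) * u.1 z.2 + F.2 (z.2, z.1) * u.2 z.2)).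
apply: (@bounded_measurable_comp _ _ _ _ _ (fun z : X * T => (z.2, z.1)) _ _
  (bm_pair_sec F u)).
by apply/measurable_fun_pairP; split => /=;
  [exact: measurable_snd|exact: measurable_fst].
Qed.

(** Fubini exchanges the integral over frequencies, hidden in [g], with the one over positions. *)
Lemma fint_ipl rho F u : g (fint rho F) u = \int[rho]_x g (sec F x) u.
Proof.
rewrite -(Rintegral_fubini mu rho (bm_pair_sec F u)).
apply: eq_Rintegral => t _; rewrite /= RintegralD //;
  try by apply: bounded_measurable_integrableT; apply: bounded_measurableM;
    rewrite /=; [exact: bm_section1 (bmfP _) _|exact: bounded_measurable_cst].
by rewrite !RintegralZr //;
  apply: bounded_measurable_integrableT; exact: bm_section1 (bmfP _) _.
Qed.

Lemma fint_ip rho rho' F F' : g (fint rho F) (fint rho' F') =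
  \int[rho]_x \int[rho']_y g (sec F x) (sec F' y).
Proof.
rewrite fint_ipl; apply: eq_Rintegral => x _.
rewrite ipC fint_ipl; apply: eq_Rintegral => y _; exact: ipC.
Qed.

Lemma bm_ip_sec_fint rho' F F' :
  bounded_measurable (fun x => \int[rho']_y g (sec F x) (sec F' y)).
Proof.
have -> : (fun x => \int[rho']_y g (sec F x) (sec F' y)) =
    (fun x => g (sec F x) (fint rho' F')).
  apply/funext => x; rewrite [RHS]ipC fint_ipl.
  by apply: eq_Rintegral => y _; exact: ipC.
exact: bm_ip_sec.
Qed.

Lemma fint_ip_ge (rho rho' : probability X R) F F' c :
  (forall x y, c <= g (sec F x) (sec F' y)) -> c <= g (fint rho F) (fint rho' F').
Proof.
move=> cg; rewrite fint_ip.
have cstP (P : probability X R) : \int[P]_x (cst c) x = c.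
  rewrite (Rintegral_cst P measurableT).
  rewrite -[RHS]mulr1; congr (_ * _); rewrite -[RHS]/(fine 1%:E).
  by congr fine; exact: probability_setT.
rewrite -{1}(cstP rho); apply: le_Rintegral_bm => [|//|x /=].
- exact: bounded_measurable_cst.
- exact: bm_ip_sec_fint.
rewrite -{1}(cstP rho'); apply: le_Rintegral_bm => [||y]; last exact: cg.
- exact: bounded_measurable_cst.
have -> : (fun y => g (sec F x) (sec F' y)) = (fun y => g (sec F' y) (sec F x)).
  by apply/funext => y; exact: ipC.
exact: bm_ip_sec.
Qed.

End Mu.

Lemma fint_image (P : probability X R) phi (mphi : measurable_fun setT phi) :
  exists Q : probability X R, (forall A, Q A = P (phi @^-1` A)) /\
    forall F, fint Q F = fint P (comp_field mphi F).
Proof.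
pose f : {mfun X >-> X} := HB.pack phi (isMeasurableFun.Build _ _ _ _ phi mphi).
exists (distribution P f); split=> // F.
have E (h : bmf (T * X)%type R) t :
    \int[distribution P f]_x h (t, x) = \int[P]_x h (t, phi x).
  rewrite /Rintegral; congr fine; apply: integral_distribution.
    by apply/measurable_EFinP; exact: (bm_section1 (bmfP h) t).1.
  apply: bounded_measurable_integrableT.
  exact: (bounded_measurable_comp mphi (bm_section1 (bmfP h) t)).
by apply: fint_eq => t; rewrite E.
Qed.

(** Used for the convexity of the set of transforms of measures on a ball. *)
Lemma mixture_probability (P Q : probability X R) (t : R) : 0 <= t <= 1 ->
  exists S : probability X R,
    (forall A, S A = t%:E * P A + (1 - t)%:E * Q A)%E /\
    forall F, fint S F = t *: fint P F + (1 - t) *: fint Q F.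
Proof.
move=> /andP[t0 t1].
have t1' : 0 <= 1 - t by rewrite subr_ge0.
pose m1 : {measure set X -> \bar R} := mscale (NngNum t0) P.
pose m2 : {measure set X -> \bar R} := mscale (NngNum t1') Q.
pose m := msum (fun n => if n is 0%N then m1 else m2) 2.
have mE A : m A = (t%:E * P A + (1 - t)%:E * Q A)%E by exact: measure_addE.
have mT : m setT = 1%E.
  rewrite mE; transitivity (t%:E * 1 + (1 - t)%:E * 1)%E.
    by congr (_ * _ + _ * _)%E; exact: probability_setT.
  by rewrite !mule1 -EFinD addrC subrK.
pose S : probability X R := HB.pack m
  (Measure_isProbability.Build _ _ _ (msum (fun n => if n is 0%N then m1 else m2) 2) mT).
exists S; split=> [A|F]; first exact: mE.
have mixE (f : X -> R) : bounded_measurable f ->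
    \int[S]_x f x = t * \int[P]_x f x + (1 - t) * \int[Q]_x f x.
  move=> bf.
  have scaleE (M : probability X R) (r : {nonneg R}) :
      (mscale r M).-integrable setT (EFin \o f) /\
      (\int[mscale r M]_x (f x)%:E = r%:num%:E * \int[M]_x (f x)%:E)%E.
    have mf : measurable_fun setT (EFin \o f) by apply/measurable_EFinP; case: bf.
    have intM : M.-integrable setT (EFin \o f) by exact: bounded_measurable_integrableT.
    split.
      apply/integrableP; split=> //.
      rewrite ge0_integral_mscale //; last exact: measurableT_comp.
      by rewrite lte_mul_pinfty //; case/integrableP : intM.
    rewrite [LHS]integralE [X in _ = (_ * X)%E]integralE.
    rewrite !ge0_integral_mscale //; try exact: measurable_funepos;
      try exact: measurable_funeneg.
    rewrite [RHS]muleBr //; apply: fin_num_adde_defr.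
    exact: integrable_pos_fin_num.
  rewrite /Rintegral.
  have -> : (\int[S]_x (f x)%:E = \int[m1]_x (f x)%:E + \int[m2]_x (f x)%:E)%E.
    apply: (integral_measure_add measurableT (scaleE _ _).1 (scaleE _ _).1).
  rewrite (scaleE _ _).2 (scaleE _ _).2.
  rewrite fineD ?fineM //; try (rewrite ?fin_numM //);
    exact: integrable_fin_num (bounded_measurable_integrableT _ bf).
by apply: fint_eq => y; rewrite mixE //; exact: bm_section1 (bmfP _) _.
Qed.

End Fields.

(** * Inward displacements in a ball *)

Section Geometry.
Context (R : realType) (d : nat).
Implicit Types (x y z : 'rV[R]_d) (q m : 'rV[int]_d).

Lemma dotC x y : dot x y = dot y x.
Proof. by apply: eq_bigr => i _; rewrite mulrC. Qed.

Lemma dotDl x y z : dot (x + y) z = dot x z + dot y z.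
Proof. by rewrite -big_split; apply: eq_bigr => i _; rewrite mxE mulrDl. Qed.

Lemma dotZl a x y : dot (a *: x) y = a * dot x y.
Proof. by rewrite /dot mulr_sumr; apply: eq_bigr => i _; rewrite mxE mulrA. Qed.

Lemma dot_ge0 x : 0 <= dot x x.
Proof. by apply: sumr_ge0 => i _; rewrite -expr2 sqr_ge0. Qed.

Definition dot_form : semi_inner 'rV[R]_d := SemiInner dotC dotDl dotZl dot_ge0.

Lemma dotDr x y z : dot x (y + z) = dot x y + dot x z.
Proof. exact: (ipDr dot_form). Qed.

Lemma dotBr x y z : dot z (x - y) = dot z x - dot z y.
Proof. exact: (ipBr dot_form). Qed.

Lemma dotZr a x y : dot x (a *: y) = a * dot x y.
Proof. exact: (ipZr dot_form). Qed.

Lemma dot0r x : dot x 0 = 0.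
Proof. by rewrite dotC; exact: (ip0l dot_form). Qed.

Lemma enorm_ge0 x : 0 <= enorm x.
Proof. exact: sqrtr_ge0. Qed.

Lemma enormD x y : enorm (x + y) <= enorm x + enorm y.
Proof. exact: (nrmD dot_form). Qed.

Lemma enormZ a x : enorm (a *: x) = `|a| * enorm x.
Proof. exact: (nrmZ dot_form). Qed.

Lemma enorm0 : enorm (0 : 'rV[R]_d) = 0.
Proof. exact: (nrm0 dot_form). Qed.

Lemma sqr_enorm x : enorm x ^+ 2 = dot x x.
Proof. exact: (sqr_nrm dot_form). Qed.

Lemma dot_le_enorm x y : `|dot x y| <= enorm x * enorm y.
Proof.
rewrite ler_norml (ip_le_nrm dot_form) andbT lerNl.
have := ip_le_nrm dot_form (- x) y.
by rewrite -scaleN1r ipZl nrmZ normrN1 mul1r mulN1r.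
Qed.

Lemma abs_coord_le x j : `|x ord0 j| <= enorm x.
Proof.
rewrite -(@ler_pXn2r _ 2) ?nnegrE ?enorm_ge0 // real_normK ?num_real //.
rewrite sqr_enorm /dot (bigD1 j) //= -expr2 lerDl.
by apply: sumr_ge0 => i _; rewrite -expr2 sqr_ge0.
Qed.

Lemma enorm_le_sum x : enorm x <= \sum_j `|x ord0 j|.
Proof.
rewrite -(@ler_pXn2r _ 2) ?nnegrE ?enorm_ge0 ?sumr_ge0 //.
rewrite sqr_enorm /dot expr2 mulr_suml; apply: ler_sum => j _.
rewrite -expr2 -real_normK ?num_real // expr2 ler_wpM2l //.
by rewrite (bigD1 j) //= lerDl sumr_ge0.
Qed.

Lemma enorm_le_max x c : (forall j, `|x ord0 j| <= c) -> enorm x <= d%:R * c.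
Proof.
move=> xc; apply: le_trans (enorm_le_sum _) _.
have -> : d%:R * c = \sum_(j < d) c by rewrite sumr_const card_ord mulr_natl.
exact: ler_sum.
Qed.

Lemma of_latticeD q m : of_lattice (q + m) = of_lattice q + of_lattice m :> 'rV[R]_d.
Proof. by apply/rowP => j; rewrite !mxE intrD. Qed.

Lemma of_lattice0 : of_lattice 0 = 0 :> 'rV[R]_d.
Proof. by apply/rowP => j; rewrite !mxE. Qed.

Lemma of_latticeB q m : of_lattice (q - m) = of_lattice q - of_lattice m :> 'rV[R]_d.
Proof. by apply/rowP => j; rewrite !mxE intrB. Qed.

Lemma enorm_box b q : box b q -> enorm (of_lattice q : 'rV[R]_d) <= d%:R * b%:R.
Proof.
move=> bq; apply: enorm_le_max => j; rewrite mxE.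
have /andP[q0 qb] := bq j.
by rewrite -intr_norm ger0_norm // pmulrn ler_int ltW.
Qed.

Definition dir (i : 'I_d * bool) : 'rV[int]_d :=
  if i.2 then unitv i.1 else - unitv i.1.

Definition dir_coord (i : 'I_d * bool) x : R :=
  if i.2 then x ord0 i.1 else - x ord0 i.1.

Lemma abs1_unitv (j : 'I_d) : abs1 (unitv j) = 1%N.
Proof.
rewrite /abs1 (bigD1 j) //= mxE !eqxx big1 // => i ij.
by rewrite mxE (negbTE ij) andbF.
Qed.

Lemma abs1_dir i : (abs1 (dir i) <= 1)%N.
Proof. by rewrite /dir; case: i.2; rewrite ?abs1N abs1_unitv. Qed.

Lemma dot_dir i x : dot x (of_lattice (dir i)) = dir_coord i x.
Proof.
have E j : dot x (of_lattice (unitv j)) = x ord0 j.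
  rewrite /dot (bigD1 j) //= !mxE !eqxx mulr1 big1 ?addr0 // => k kj.
  by rewrite !mxE (negbTE kj) andbF mulr0.
rewrite /dir /dir_coord; case: i.2 => //.
by rewrite -[- unitv _]add0r of_latticeB of_lattice0 dotBr dot0r sub0r E.
Qed.

Lemma dot_dir_dir i : dot (of_lattice (dir i)) (of_lattice (dir i)) = 1 :> R.
Proof.
rewrite dot_dir /dir_coord /dir; case: (i.2); rewrite !mxE !eqxx //=.
by rewrite intrN opprK.
Qed.

(** The coordinate of largest absolute value, taken with its sign, is a suitable direction. *)
Lemma dir_cover x : (0 < d)%N -> exists i, enorm x <= d%:R * dir_coord i x.
Proof.
move=> d0; pose j := [arg max_(i > Ordinal d0) `|x ord0 i|]%O.
have jP k : `|x ord0 k| <= `|x ord0 j|.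
  by rewrite /j; case: Order.TotalTheory.arg_maxP => //= i _; exact.
exists (j, 0 <= x ord0 j).
have -> : dir_coord (j, 0 <= x ord0 j) x = `|x ord0 j|.
  rewrite /dir_coord /=; case: ifPn => [x0|]; first by rewrite ger0_norm.
  by rewrite -ltNge => /ltr0_norm ->.
exact: enorm_le_max.
Qed.

(* Moving by [u] against the coordinate direction closest to [z] decreases
   the norm of [z] by at least [u / (2 * d)]. *)
Lemma enorm_inward z i (u : R) (T : R) : (0 < d)%N -> 0 <= u ->
  2 * d%:R * u <= T ->  T <= 2 * enorm z -> enorm z <= d%:R * dir_coord i z ->
  enorm (z - u *: of_lattice (dir i)) <= enorm z - u / (2 * d%:R).
Proof.
move=> d0 u0 uT Tz zi; have d1 : (1 : R) <= d%:R by rewrite ler1n.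
have dp : (0 : R) < d%:R by lra.
set n := enorm z in Tz zi *.
have uz : u * d%:R <= n by lra.
have rhs0 : 0 <= n - u / (2 * d%:R).
  rewrite subr_ge0 ler_pdivrMr; last lra.
  have h : u <= u * d%:R by rewrite ler_peMr.
  have n0 : 0 <= n by exact: enorm_ge0.
  have h2 : n <= n * d%:R by rewrite ler_peMr.
  lra.
rewrite -(@ler_pXn2r _ 2) ?nnegrE ?enorm_ge0 // sqr_enorm.
rewrite !dotBr [dot (_ - _) z]dotC [dot (_ - _) (_ *: _)]dotC !dotBr.
rewrite !(dotZl, dotZr) dot_dir_dir [dot (of_lattice _) z]dotC dot_dir.
rewrite -sqr_enorm -/n.
(* The square of the norm drops by [2 * u * dir_coord i z - u ^+ 2], which is at least [u * (n / d)]
   since [u <= n / d]. This is exactly the double product in the square of the right-hand side. *)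
have h1 : n / d%:R <= dir_coord i z by rewrite ler_pdivrMr // mulrC.
have h2 : 2 * u * (n / d%:R) <= 2 * u * dir_coord i z.
  by rewrite ler_wpM2l // mulr_ge0.
have h3 : u ^+ 2 <= u * (n / d%:R).
  by rewrite expr2 ler_wpM2l // ler_pdivlMr.
rewrite sqrrB (_ : n * (u / (2 * d%:R)) *+ 2 = u * (n / d%:R)); last first.
  by rewrite -mulr_natr; field; lra.
have := sqr_ge0 (u / (2 * d%:R)); lra.
Qed.

(** When [2 * enorm z >= T], the displacement by [6 d^2 b] shortens [z] by [3 d b], which absorbs
    the excess [(1 + d) b] and the box vector of length at most [d b]. Otherwise the total
    displacement is at most [7 d^3 b], and the constant [14] makes this at most [T / 2]. *)
Lemma inward_in_ball z i q (b : nat) (T : R) : (0 < d)%N -> box b q ->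
  14 * d%:R ^+ 3 * b%:R <= T ->
  enorm z <= T + (1 + d%:R) * b%:R -> enorm z <= d%:R * dir_coord i z ->
  enorm (z + of_lattice (q - dir i *+ (6 * d ^ 2 * b))) <= T.
Proof.
move=> d0 bq bT zT zi; have d1 : (1 : R) <= d%:R by rewrite ler1n.
set D : R := d%:R in d1 bT zT zi *.
have b0 : (0 : R) <= b%:R by exact: ler0n.
set u : R := 6 * D ^+ 2 * b%:R.
have u0 : 0 <= u by rewrite !mulr_ge0 // exprn_ge0 //; lra.
rewrite of_latticeB.
have -> : of_lattice (dir i *+ (6 * d ^ 2 * b)) =
    u *: of_lattice (dir i) :> 'rV[R]_d.
  apply/rowP => j; rewrite !mxE mulmxnE rmorphMn /= -mulr_natl.
  by rewrite /u /D !natrM expr2.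
rewrite addrCA addrC; apply: le_trans (enormD _ _) _.
have qD := enorm_box bq; rewrite -/D in qD.
have D23 : D ^+ 2 * b%:R <= D ^+ 3 * b%:R.
  by rewrite ler_wpM2r // [leRHS]exprS ler_peMl ?exprn_ge0 //; lra.
have D12 : D * b%:R <= D ^+ 2 * b%:R by rewrite ler_wpM2r // expr2 ler_peMl //; lra.
have b1D : b%:R <= D * b%:R by rewrite ler_peMl.
have [Tz|zT2] := leP T (2 * enorm z).
  have u2D : u / (2 * D) = 3 * (D * b%:R) by rewrite /u; field; lra.
  have uT : 2 * D * u <= T.
    apply: le_trans bT; rewrite (_ : 2 * D * u = 12 * (D ^+ 3 * b%:R)); last first.
      by rewrite /u; ring.
    rewrite -[leRHS]mulrA ler_wpM2r ?mulr_ge0 ?exprn_ge0 //; lra.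
  have := enorm_inward d0 u0 uT Tz zi; rewrite -/D u2D; lra.
have := enormD z (- (u *: of_lattice (dir i))).
rewrite -scaleNr enormZ normrN (ger0_norm u0).
rewrite [enorm (of_lattice _)](_ : _ = 1); last first.
  by rewrite /enorm dot_dir_dir sqrtr1.
rewrite scaleNr mulr1 /u; lra.
Qed.

End Geometry.

(** * Means over finite types, measurable selection and counting in boxes *)

Lemma convexP_mean_fin (R : realType) (H : lmodType R) (V : H -> Prop)
    (J : finType) (F : J -> H) : convexP V -> (0 < #|J|)%N ->
  (forall j, V (F j)) -> V (#|J|%:R^-1 *: \sum_j F j).
Proof.
move=> cV J0 VF; have [j0 _] := card_gt0P J0.
have := @convexP_mean _ _ V #|J| (fun i => F (nth j0 (enum J) i)) cV J0
  (fun i _ => VF _).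
rewrite -(big_mkord xpredT (fun i => F (nth j0 (enum J) i))).
by rewrite cardE -(big_nth j0 xpredT F) big_enum.
Qed.

(** The first admissible index in the enumeration of [I] is a measurable choice. *)
Lemma measurable_choice dX (X : measurableType dX) (I : finType) (i0 : I)
    (A : I -> set X) : (forall i, measurable (A i)) ->
  (forall x, exists i, A i x) -> exists c : X -> I,
    (forall i, measurable (c @^-1` [set i])) /\ forall x, A (c x) x.
Proof.
move=> mA cA.
suff [c [mc cP]] : exists c : X -> I, (forall i, measurable (c @^-1` [set i])) /\
    forall x, (exists2 i, i \in enum I & A i x) -> A (c x) x.
  exists c; split=> // x; apply: cP; have [i Aix] := cA x; exists i => //.
  by rewrite mem_enum.
elim: (enum I) => [|k l [c [mc cP]]].
  exists (fun=> i0); split=> [i|x [i //]].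
  by rewrite preimage_cst; case: ifP => _; [exact: measurableT|exact: measurable0].
exists (fun x => if x \in A k then k else c x); split=> [i|x [i]].
  rewrite (_ : _ @^-1` _ = (A k `&` [set _ | k = i]) `|` (~` A k `&` c @^-1` [set i])).
    apply: measurableU; apply: measurableI => //; last exact: measurableC.
    have [->|/eqP ki] := eqVneq k i.
      by rewrite (_ : [set _ | _] = setT) //; apply/seteqP; split.
    by rewrite (_ : [set _ | _] = set0) //; apply/seteqP; split.
  apply/seteqP; split=> x /=.
    case: ifPn => [/set_mem Akx ki|/negP Akx ci]; [by left|right].
    by split=> // Akx'; apply: Akx; exact/mem_set.
  case=> [[Akx ki]|[Akx ci]]; first by rewrite mem_set.
  by rewrite memNset.
rewrite inE => /orP[/eqP-> Akx|il Aix]; first by rewrite mem_set.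
case: ifPn => [/set_mem //|_]; apply: cP; by exists i.
Qed.

Lemma count_near (R : realType) (z r : R) (a : nat) : 0 <= r ->
  \sum_(s < a) (`|z + s%:R| < r)%R%:R <= 2 * r + 1.
Proof.
(* The second bound counts the hits from the left end [- r] of the interval. A hit at [s = a] forces
   [a + z + r < 2 * r], so the second bound for [a] gives the first one for [a + 1]. *)
move=> r0; suff: \sum_(s < a) (`|z + s%:R| < r)%R%:R <= 2 * r + 1 /\
    \sum_(s < a) (`|z + s%:R| < r)%R%:R <= Num.max 0 (a%:R + z + r) by case.
elim: a => [|a [IH1 IH2]].
  by rewrite big_ord0; split; [lra|rewrite le_max lexx].
rewrite big_ord_recr /=; set S := \sum_(_ < _) _ in IH1 IH2 *.
move: IH2; rewrite -natr1 !le_max.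
case: (ltrP _ r) => [|_].
  rewrite ltr_norml mulr1n => /andP[h1 h2] /orP[h|h];
    (split; last (apply/orP; right)); lra.
rewrite mulr0n addr0 => /orP[h|h]; split => //; apply/orP; [left|right]; lra.
Qed.

Section Box.
Context (R : realType) (d a : nat).
Local Notation F := {ffun 'I_d -> 'I_a}.

Definition vec (f : F) : 'rV[int]_d := \row_j (f j)%:Z.

Lemma box_vec f : box a (vec f).
Proof. by move=> j; rewrite mxE ltz_nat ltn_ord. Qed.

Lemma card_box : #|F| = (a ^ d)%N.
Proof. by rewrite card_ffun !card_ord. Qed.

(** The indicator is a product over the coordinates, so the sum over the box factors into
    one-dimensional counts. *)
Lemma count_near_box (z : 'I_d -> R) (r : R) : 0 <= r ->
  \sum_(f : F) [forall j, `|z j + (f j)%:R| < r]%R%:R <= (2 * r + 1) ^+ d.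
Proof.
move=> r0; under eq_bigr => f _.
  rewrite (_ : _%:R = \prod_j (`|z j + (f j)%:R| < r)%R%:R); last first.
    case: (boolP [forall j, _]) => [/forallP h|].
      by rewrite big1 // => j _; rewrite h.
    by rewrite negb_forall => /existsP[j /negbTE h]; rewrite (bigD1 j) //= h mul0r.
  over.
rewrite -(bigA_distr_bigA (fun j (s : 'I_a) => (`|z j + s%:R| < r)%R%:R)).
rewrite -[in leRHS](card_ord d) -prodr_const; apply: ler_prod => j _.
by rewrite sumr_ge0 //= count_near.
Qed.

End Box.

(** * Kernels with a spectral measure *)

Definition phase (R : realType) (d : nat) (l x : 'rV[R]_d) : R := 2 * pi * dot l x.

Lemma phaseD (R : realType) (d : nat) (l x y : 'rV[R]_d) :
  phase l (x + y) = phase l x + phase l y.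
Proof. by rewrite /phase dotDr mulrDr. Qed.

Lemma phaseB (R : realType) (d : nat) (l x y : 'rV[R]_d) :
  phase l (x - y) = phase l x - phase l y.
Proof. by rewrite /phase dotBr mulrBr. Qed.

(* A common description of the two settings: points [x] of [X] have coordinates
   [co x], integer vectors translate them by [tr], and a frequency [l] acts on
   them through the vector [fr l]; [fr] need not be measurable. *)
Record spectral_space (R : realType) (d : nat) dX (X : measurableType dX)
    dL (L : measurableType dL) := SpectralSpace {
  co : X -> 'rV[R]_d ;
  fr : L -> 'rV[R]_d ;
  tr : 'rV[int]_d -> X -> X ;
  orig : X ;
  co_orig : co orig = 0 ;
  co_tr : forall m x, co (tr m x) = co x + of_lattice m ;
  measurable_co : forall j, measurable_fun setT (fun x => co x ord0 j) ;
  measurable_tr : forall m, measurable_fun setT (tr m) ;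
  measurable_cos_phase :
    measurable_fun setT (fun z : L * X => cos (phase (fr z.1) (co z.2))) ;
  measurable_sin_phase :
    measurable_fun setT (fun z : L * X => sin (phase (fr z.1) (co z.2))) }.

Section Kernel.
Context (R : realType) (d : nat) dX (X : measurableType dX)
  dL (L : measurableType dL).
Variables (S : spectral_space R d X L) (mu : {finite_measure set L -> \bar R}).

Local Notation co := (co S).
Local Notation fr := (fr S).
Local Notation tr := (tr S).
Local Notation g := (pair_form mu).
Local Notation H := (bmf L R * bmf L R)%type.

Lemma bm_cos_phase :
  bounded_measurable (fun z : L * X => cos (phase (fr z.1) (co z.2))).
Proof.
split; first exact: measurable_cos_phase.
by exists 1 => z; rewrite ler_norml cos_geN1 cos_le1.
Qed.

Lemma bm_sin_phase :
  bounded_measurable (fun z : L * X => sin (phase (fr z.1) (co z.2))).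
Proof.
split; first exact: measurable_sin_phase.
by exists 1 => z; rewrite ler_norml sin_geN1 sin_le1.
Qed.

(** The feature map of the kernel: its section at [x] is the character [exp (i * phase)], so
    [fint nu feature] is the transform of [nu]. *)
Definition feature : field L X R := (bmf_of bm_cos_phase, bmf_of bm_sin_phase).

Local Notation phi := (sec feature).

(** As [fr] may fail to be measurable, measurability in the frequency is read off the joint one at
    the point [tr m (orig S)], whose coordinates are those of [m]. *)
Lemma bm_cos_lattice m :
  bounded_measurable (fun l => cos (phase (fr l) (of_lattice m))).
Proof.
have -> : (fun l => cos (phase (fr l) (of_lattice m))) =
    (fun l => cos (phase (fr l) (co (tr m (orig S))))).
  by apply/funext => l; rewrite co_tr co_orig add0r.
exact: (bm_section2 bm_cos_phase).
Qed.

Lemma bm_sin_lattice m :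
  bounded_measurable (fun l => sin (phase (fr l) (of_lattice m))).
Proof.
have -> : (fun l => sin (phase (fr l) (of_lattice m))) =
    (fun l => sin (phase (fr l) (co (tr m (orig S))))).
  by apply/funext => l; rewrite co_tr co_orig add0r.
exact: (bm_section2 bm_sin_phase).
Qed.

Lemma cos_latticeD m n l : cos (phase (fr l) (of_lattice (m + n))) =
  cos (phase (fr l) (of_lattice m)) * cos (phase (fr l) (of_lattice n)) -
  sin (phase (fr l) (of_lattice m)) * sin (phase (fr l) (of_lattice n)).
Proof. by rewrite of_latticeD phaseD cosD. Qed.

Lemma sin_latticeD m n l : sin (phase (fr l) (of_lattice (m + n))) =
  sin (phase (fr l) (of_lattice m)) * cos (phase (fr l) (of_lattice n)) +
  cos (phase (fr l) (of_lattice m)) * sin (phase (fr l) (of_lattice n)).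
Proof. by rewrite of_latticeD phaseD sinD. Qed.

Lemma cos2_sin2_lattice m l : cos (phase (fr l) (of_lattice m)) ^+ 2 +
  sin (phase (fr l) (of_lattice m)) ^+ 2 = 1.
Proof. exact: cos2Dsin2. Qed.

Lemma cos_lattice0 l : cos (phase (fr l) (of_lattice 0)) = 1.
Proof. by rewrite of_lattice0 /phase dot0r mulr0 cos0. Qed.

Lemma sin_lattice0 l : sin (phase (fr l) (of_lattice 0)) = 0.
Proof. by rewrite of_lattice0 /phase dot0r mulr0 sin0. Qed.

Definition translation : shift_action g d :=
  rotation_action mu bm_cos_lattice bm_sin_lattice cos_latticeD sin_latticeD
    cos2_sin2_lattice cos_lattice0 sin_lattice0.

Local Notation rot := (translation : 'rV[int]_d -> H -> H).

Definition ker (x y : X) : R := g (phi x) (phi y).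

Lemma kerE x y : ker x y = \int[mu]_l cos (phase (fr l) (co x - co y)).
Proof. by apply: eq_Rintegral => l _; rewrite phaseB cosB. Qed.

Lemma sec_tr m x : phi (tr m x) = rot m (phi x).
Proof.
apply: sec_eq => l /=; rewrite co_tr phaseD.
  by rewrite cosD; ring.
by rewrite sinD; ring.
Qed.

Lemma rot_fint m (rho : {finite_measure set X -> \bar R}) F F' :
  (forall x, sec F' x = rot m (sec F x)) -> rot m (fint rho F) = fint rho F'.
Proof.
move=> FF'; apply/esym.
pose c l := cos (phase (fr l) (of_lattice m)).
pose s l := sin (phase (fr l) (of_lattice m)).
have E1 l x : F'.1 (l, x) = c l * F.1 (l, x) - s l * F.2 (l, x).
  exact: (congr1 (fun u : H => u.1 l) (FF' x)).
have E2 l x : F'.2 (l, x) = s l * F.1 (l, x) + c l * F.2 (l, x).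
  exact: (congr1 (fun u : H => u.2 l) (FF' x)).
have b1 l := bm_section1 (bmfP F.1) l.
have b2 l := bm_section1 (bmfP F.2) l.
apply: fint_eq => l /=.
  under eq_Rintegral do rewrite E1 /=.
  rewrite RintegralB //; try by apply: bounded_measurable_integrableT;
    apply: bounded_measurableM => //; exact: bounded_measurable_cst.
  by rewrite !RintegralZ_bm.
under eq_Rintegral do rewrite E2 /=.
rewrite RintegralD //; try by apply: bounded_measurable_integrableT;
  apply: bounded_measurableM => //; exact: bounded_measurable_cst.
by rewrite !RintegralZ_bm.
Qed.

Definition ball (T : R) : set X := [set x | enorm (co x) <= T].

Lemma measurable_enorm : measurable_fun setT (fun x => enorm (co x)).
Proof.
apply: (measurableT_comp (continuous_measurable_fun (@sqrt_continuous R))).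
apply: measurable_sum => j.
exact: measurable_funM (measurable_co S j) (measurable_co S j).
Qed.

Lemma measurable_ball T : measurable (ball T).
Proof.
have := measurable_fun_ler measurable_enorm (measurable_cst T).
by move/(_ measurableT [set true] I); rewrite setTI preimage_true.
Qed.

(** The convex set to which the Banach-Saks argument is applied. *)
Definition attained (T : R) (z : H) : Prop := exists rho : probability X R,
  rho (ball T) = 1%E /\ z = fint rho feature.

Lemma convexP_attained T : convexP (attained T).
Proof.
move=> _ _ t t01 [P [PT ->]] [Q [QT ->]].
have [M [ME MF]] := mixture_probability L P Q t01.
exists M; split; last by rewrite MF.
by rewrite ME PT QT !mule1 -EFinD addrC subrK.
Qed.

Lemma attained_image (T T' : R) (nu : probability X R) (f : X -> X)
    (mf : measurable_fun setT f) : nu (ball T') = 1%E ->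
  (forall x, ball T' x -> ball T (f x)) ->
  attained T (fint nu (comp_field mf feature)).
Proof.
move=> nuT' fT; have [Q [QE QF]] := fint_image L nu mf.
exists Q; split; last by rewrite QF.
apply/eqP; rewrite eq_le probability_le1 /=; last exact: measurable_ball.
rewrite QE -nuT' le_measure ?inE //; first exact: measurable_ball.
rewrite -[_ @^-1` _]setTI; apply: (mf) => //; exact: measurable_ball.
Qed.

End Kernel.

(** * Transfer of a measure to a smaller ball *)

Section Transfer.
Context (R : realType) (d : nat) dX (X : measurableType dX)
  dL (L : measurableType dL).
Variables (S : spectral_space R d X L) (mu : {finite_measure set L -> \bar R}).
Hypothesis d_gt0 : (0 < d)%N.

Local Notation co := (co S).
Local Notation tr := (tr S).
Local Notation ball := (ball S).
Local Notation g := (pair_form mu).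
Local Notation nrm := (nrm g).
Local Notation H := (bmf L R * bmf L R)%type.
Local Notation Phi := (feature S).
Local Notation phi := (sec Phi).
Local Notation rot := (translation S mu : 'rV[int]_d -> H -> H).
Local Notation ker := (ker S mu).
Local Notation I := ('I_d * bool)%type.

Lemma measurable_cells : exists c : X -> I,
  (forall i, measurable (c @^-1` [set i])) /\
  forall x, enorm (co x) <= d%:R * dir_coord (c x) (co x).
Proof.
apply: (measurable_choice (Ordinal d_gt0, true)
  (A := fun i => [set x | enorm (co x) <= d%:R * dir_coord i (co x)])).
  move=> i; have h : measurable_fun setT (fun x => d%:R * dir_coord i (co x)).
    apply: measurable_funM; first exact: measurable_cst.
    rewrite /dir_coord; case: i.2; first exact: measurable_co.
    exact: measurableT_comp (measurable_co S i.1).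
  have := measurable_fun_ler (measurable_enorm S) h.
  by move/(_ measurableT [set true] Logic.I); rewrite setTI preimage_true.
by move=> x; exact: dir_cover.
Qed.

Variables (nu : probability X R) (a : nat) (c : X -> I).
Hypothesis a_gt0 : (0 < a)%N.
Hypothesis mc : forall i, measurable (c @^-1` [set i]).

Local Notation F := {ffun 'I_d -> 'I_a}.
Local Notation nF := #|F|.

Let n_gt0 : (0 < nF)%N.
Proof. by rewrite card_box expn_gt0 a_gt0. Qed.

Let n_neq0 : nF%:R != 0 :> R.
Proof. by rewrite pnatr_eq0 -lt0n. Qed.

Definition cell (i : I) (f : F) : set X := tr (vec f) @^-1` (c @^-1` [set i]).

Lemma measurable_cell i f : measurable (cell i f).
Proof. by rewrite -[cell i f]setTI; apply: measurable_tr. Qed.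

(** The averaged cut: for each box vector the whole measure is translated first and then cut along
    the fixed cells, and the results are averaged. The vector [q] is a further displacement of the
    piece. *)
Definition cell_field q i : field L X R := nF%:R^-1 *: \sum_f
  loc_field (measurable_cell i f) (comp_field (measurable_tr S (q + vec f)) Phi).

Lemma sec_cell_field q i x : sec (cell_field q i) x =
  nF%:R^-1 *: \sum_f (\1_(cell i f) x : R) *: rot q (phi (tr (vec f) x)).
Proof.
rewrite secZ sec_sum; congr (_ *: _); apply: eq_bigr => f _.
by rewrite sec_loc sec_comp !(sec_tr S mu) tau_add.
Qed.

Definition piece i : H := fint nu (cell_field 0 i).

Lemma rot_piece q i : rot q (piece i) = fint nu (cell_field q i).
Proof.
apply: rot_fint => x; rewrite !sec_cell_field tauZ tau_sum; congr (_ *: _).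
by apply: eq_bigr => f _; rewrite tauZ tau0.
Qed.

Definition shift_map (q : I -> 'rV[int]_d) (f : F) (x : X) : X :=
  tr (q (c (tr (vec f) x)) + vec f) x.

Lemma measurable_shift_map q f : measurable_fun setT (shift_map q f).
Proof.
move=> _ B mB; rewrite setTI.
rewrite (_ : _ @^-1` _ = \bigcup_(i in [set: I])
  (cell i f `&` tr (q i + vec f) @^-1` B)).
  apply: fin_bigcup_measurable => [//|i _].
  apply: measurableI; first exact: measurable_cell.
  by rewrite -[_ @^-1` _]setTI; apply: measurable_tr.
apply/seteqP; split=> [x Bx|x [i _ [/= <-]]] //.
by exists (c (tr (vec f) x)).
Qed.

(** For each box vector [f] the cells partition [X], so displacing the pieces separately amounts to
    transporting [nu] by the single map [shift_map q f]. *)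
Lemma sum_rot_piece q : \sum_i rot (q i) (piece i) =
  nF%:R^-1 *: \sum_f fint nu (comp_field (measurable_shift_map q f) Phi).
Proof.
under eq_bigr do rewrite rot_piece.
rewrite -fint_sum -fint_sum -fintZ; congr fint; apply: sec_ext => x.
rewrite sec_sum secZ sec_sum; under eq_bigr do rewrite sec_cell_field.
rewrite -scaler_sumr exchange_big /=; congr (_ *: _); apply: eq_bigr => f _.
rewrite sec_comp (bigD1 (c (tr (vec f) x))) //= big1 ?addr0.
  by rewrite indicE mem_set // scale1r !(sec_tr S mu) tau_add.
move=> i /eqP ic; rewrite indicE memNset ?scale0r // => ci.
by apply: ic; rewrite ci.
Qed.

Let E := g (fint nu Phi) (fint nu Phi).

(** Undisplaced pieces add up to an average of translates of the transform of [nu], and translations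
    are isometries. *)
Lemma ip_sum_piece : g (\sum_i piece i) (\sum_i piece i) <= E.
Proof.
have -> : \sum_(i : I) piece i = nF%:R^-1 *: \sum_(f : F) rot (vec f) (fint nu Phi).
  under eq_bigr do rewrite -[piece _](tau0 (translation S mu)).
  rewrite (sum_rot_piece (fun=> 0)); congr (_ *: _); apply: eq_bigr => f _.
  by apply/esym/rot_fint => x; rewrite sec_comp (sec_tr S mu) add0r.
rewrite /E -!(sqr_nrm g) ler_pXn2r ?nnegrE ?nrm_ge0 // nrmZ.
rewrite ger0_norm ?invr_ge0 ?ler0n // ler_pdivrMl ?ltr0n //.
apply: le_trans (nrm_sum _ _ _ _) _.
under eq_bigr do rewrite (tau_nrm (translation S mu)).
by rewrite sumr_const mulr_natl.
Qed.

(** * Control of the negative part of the kernel *)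

Section Negligible.
Variables (k0 r : R).
Hypotheses (k0_ge0 : 0 <= k0) (r_ge0 : 0 <= r).
Hypothesis ker_ge : forall x y,
  - (k0 * [forall j, (`|co x ord0 j - co y ord0 j| < r)%R]%:R) <= ker x y.

(* For fixed [x] and [y], at most [(2 * r + 1) ^+ d] of the [nF] translates of [x]
   by the vectors of the box are close to [y]. *)
Let delta := k0 * (2 * r + 1) ^+ d / nF%:R.

Lemma delta_ge0 : 0 <= delta.
Proof. by rewrite divr_ge0 ?ler0n // mulr_ge0 // exprn_ge0 // addr_ge0 // mulr_ge0. Qed.

Lemma ip_piece_ge i j : - delta <= g (piece i) (piece j).
Proof.
apply: fint_ip_ge => x y; rewrite !sec_cell_field ipZl ipZr mulrA ip_suml.
have near_le f' : \sum_(f : F) [forall j0, (`|co (tr (vec f) x) ord0 j0 -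
    co (tr (vec f') y) ord0 j0| < r)%R]%:R <= (2 * r + 1) ^+ d.
  apply: le_trans (count_near_box a (fun j0 => co x ord0 j0 -
    co (tr (vec f') y) ord0 j0) r_ge0).
  apply: ler_sum => f _; rewrite ler_nat leq_eqVlt; apply/orP; left; apply/eqP.
  congr nat_of_bool; apply: eq_forallb => j0; rewrite co_tr !mxE.
  by rewrite addrAC.
(* The bound is non-positive, so it also holds for the terms killed by the indicators. *)
have term f f' : - (k0 * [forall j0, (`|co (tr (vec f) x) ord0 j0 -
      co (tr (vec f') y) ord0 j0| < r)%R]%:R) <=
    g ((\1_(cell i f) x : R) *: rot 0 (phi (tr (vec f) x)))
      ((\1_(cell j f') y : R) *: rot 0 (phi (tr (vec f') y))).
  rewrite ipZl ipZr (tau_ip (translation S mu)) !indicE.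
  case: (_ \in _); case: (_ \in _); rewrite ?mul1r ?mul0r;
    [exact: ker_ge|by rewrite oppr_le0 mulr_ge0 ?ler0n..].
apply: (@le_trans _ _ (nF%:R^-1 * nF%:R^-1 * \sum_(f' : F) \sum_(f : F)
   - (k0 * [forall j0, (`|co (tr (vec f) x) ord0 j0 -
      co (tr (vec f') y) ord0 j0| < r)%R]%:R))).
  rewrite -mulrA lerNl -mulrN -mulrN -sumrN.
  have -> : delta = nF%:R^-1 * (nF%:R^-1 * \sum_(f' : F) k0 * (2 * r + 1) ^+ d).
    by rewrite sumr_const -[_ *+ _]mulr_natl /delta; field.
  rewrite !ler_wpM2l ?invr_ge0 ?ler0n //; apply: ler_sum => f' _.
  by rewrite -sumrN; under eq_bigr do rewrite opprK; rewrite -mulr_sumr ler_wpM2l.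
rewrite ler_wpM2l ?mulr_ge0 ?invr_ge0 ?ler0n // exchange_big.
by apply: ler_sum => f _; rewrite ip_sumr; apply: ler_sum => f' _; exact: term.
Qed.

(** In the expansion of the squared norm of the sum of the pieces, all other inner products are at
    least [- delta], so the square of one piece exceeds [E] by at most their number times
    [delta]. *)
Lemma ip_piece_le i :
  g (piece i) (piece i) <= E + (#|{: I}|%:R + #|{: I}|%:R ^+ 2) * delta.
Proof.
have D : g (\sum_j piece j) (\sum_j piece j) = g (piece i) (piece i) +
    \sum_(j | j != i) g (piece i) (piece j) +
    \sum_(k | k != i) g (piece k) (\sum_j piece j).
  rewrite ip_suml [LHS](bigD1 i) //; congr (_ + _).
  by rewrite ip_sumr [LHS](bigD1 i).
have := ip_sum_piece; rewrite D => {D}.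
have h1 : - (#|{: I}|%:R * delta) <= \sum_(j | j != i) g (piece i) (piece j).
  apply: (@le_trans _ _ (\sum_(j | j != i) - delta)).
    rewrite sumr_const -[leRHS]mulr_natl mulrN lerN2 ler_wpM2r ?delta_ge0 //.
    by rewrite ler_nat max_card.
  by apply: ler_sum => j _; exact: ip_piece_ge.
have h2 : - (#|{: I}|%:R * (#|{: I}|%:R * delta)) <=
    \sum_(k | k != i) g (piece k) (\sum_j piece j).
  apply: (@le_trans _ _ (\sum_(k : I | k != i) - (#|{: I}|%:R * delta))).
    rewrite sumr_const -[leRHS]mulr_natl mulrN lerN2 ler_wpM2r //.
      by rewrite mulr_ge0 ?ler0n ?delta_ge0.
    by rewrite ler_nat max_card.
  apply: ler_sum => k _; rewrite ip_sumr.
  apply: (@le_trans _ _ (\sum_(j : I) - delta)).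
    by rewrite sumr_const -[leRHS]mulr_natl mulrN.
  by apply: ler_sum => j _; exact: ip_piece_ge.
rewrite mulrDl expr2 -mulrA; lra.
Qed.

Hypothesis cP : forall x, enorm (co x) <= d%:R * dir_coord (c x) (co x).
Variables (T w t : R) (p N : nat).
Hypothesis p_gt0 : (0 < p)%N.
Hypothesis w_le : w <= a%:R.
Hypothesis nuT : nu (ball (T + w)) = 1%E.
Hypothesis apN_le : 14 * d%:R ^+ 3 * (a * p ^ N)%:R <= T.
Hypothesis delta_le : (#|{: I}|%:R + #|{: I}|%:R ^+ 2) * delta <= E.

(** The width [w] and the box vector of the cut are both controlled by [a <= a * p ^ k], so
    [inward_in_ball] at the scale [a * p ^ k] brings the ball of radius [T + w] into that of radius
    [T]. *)
Lemma attained_shift k q : (k <= N)%N -> box (a * p ^ k) q ->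
  attained S T (\sum_i rot (q - dir i *+ (6 * d ^ 2 * (a * p ^ k))) (piece i)).
Proof.
move=> kN bq; pose q' i := q - dir i *+ (6 * d ^ 2 * (a * p ^ k)).
rewrite (sum_rot_piece q').
apply: convexP_mean_fin => [|//|f]; first exact: convexP_attained.
apply: attained_image nuT _ => x xT; rewrite /ball /= /shift_map co_tr.
rewrite of_latticeD addrCA -co_tr addrC.
have ak : a%:R <= (a * p ^ k)%:R :> R.
  by rewrite ler_nat leq_pmulr // expn_gt0 p_gt0.
apply: inward_in_ball => //.
  apply: le_trans apN_le; rewrite ler_wpM2l ?mulr_ge0 ?exprn_ge0 ?ler0n //.
  by rewrite ler_nat leq_mul2l leq_pexp2l // orbT.
rewrite co_tr (le_trans (enormD _ _)) //.
have := enorm_box R (box_vec f); move: xT; rewrite /ball /= => xT fd.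
have : d%:R * a%:R <= d%:R * (a * p ^ k)%:R :> R by rewrite ler_wpM2l ?ler0n.
rewrite mulrDl mul1r; move: xT fd w_le ak; lra.
Qed.

Lemma sum_nrm_piece : \sum_i nrm (piece i) <= 2 * #|{: I}|%:R * Num.sqrt E.
Proof.
have -> : 2 * #|{: I}|%:R * Num.sqrt E = \sum_(i : I) 2 * Num.sqrt E.
  by rewrite sumr_const -[RHS]mulr_natl mulrCA mulrA.
apply: ler_sum => i _.
(* [ip_piece_le] and [delta_le] bound each square by [2 * E], rounded up here to [4 * E]. *)
have -> : 2 * Num.sqrt E = Num.sqrt (2 ^+ 2 * E).
  by rewrite sqrtrM ?sqr_ge0 // sqrtr_sqr ger0_norm.
rewrite ler_wsqrtr //; have := ip_piece_le i.
have := ip_ge0 g (fint nu Phi); rewrite -/E; move: delta_le; lra.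
Qed.

Lemma transfer : 0 <= t <= 1 -> let B : R := 2 * #|{: I}|%:R in
  exists2 Z, attained S T Z & g Z Z <=
  (1 + 2 * ((6 * d ^ 2 + d)%:R * (2 * B ^+ 2 / p%:R)) + t * B ^+ 2 +
   (1 - t) ^+ N * B ^+ 2) * E.
Proof.
move=> t01 B; apply: (banach_saks (s := translation S mu) (v := piece)
  (e := @dir d) (a := a)) => //.
- exact: convexP_attained.
- exact: abs1_dir.
- exact: ip_ge0.
- exact: ip_sum_piece.
- exact: sum_nrm_piece.
- by rewrite mulr_ge0 ?ler0n.
- exact: attained_shift.
Qed.

End Negligible.
End Transfer.

(** Each of the three error terms is made at most [kappa / 4]; the number [N] of scales is chosen
    after the weight [t]. *)
Lemma banach_saks_parameters (R : realType) (kappa B : R) (c : nat) :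
  0 < kappa -> exists t p N, [/\ 0 <= t <= 1, (0 < p)%N &
    1 + 2 * (c%:R * (2 * B ^+ 2 / p%:R)) + t * B ^+ 2 + (1 - t) ^+ N * B ^+ 2
      <= 1 + kappa].
Proof.
move=> k0; set D := B ^+ 2; have D0 : 0 <= D by exact: sqr_ge0.
(* [D + 1] avoids a division by zero, and the cap [1 / 2] keeps [1 - t] positive. *)
pose t := Num.min (1 / 2) (kappa / (4 * (D + 1))).
have t0 : 0 < t by rewrite lt_min divr_gt0 ?divr_gt0 ?mulr_gt0 ?ltr_pwDr.
have t1 : t <= 1 / 2 by rewrite ge_min lexx.
have tD : t * D <= kappa / 4.
  apply: (@le_trans _ _ (kappa / (4 * (D + 1)) * D)).
    by rewrite ler_wpM2r // ge_min lexx orbT.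
  rewrite -mulrA ler_wpM2l ?(ltW k0) // [leLHS]mulrC.
  by rewrite ler_pdivrMr ?mulr_gt0 ?ltr_pwDr //; lra.
have [p [p0 pP]] : exists p, (0 < p)%N /\ 16 * c%:R * D / kappa < p%:R.
  exists (Num.truncn (16 * c%:R * D / kappa)).+1; split=> //.
  exact: truncnS_gt.
have pE : 2 * (c%:R * (2 * D / p%:R)) <= kappa / 4.
  have -> : 2 * (c%:R * (2 * D / p%:R)) = 4 * c%:R * D / p%:R by ring.
  rewrite ler_pdivrMr ?ltr0n //; move: pP; rewrite ltr_pdivrMr //; lra.
have /cvgrPdist_lt/(_ (kappa / (4 * (D + 1)))) : (1 - t) ^+ n @[n --> \oo] --> 0.
  by apply: cvg_expr; rewrite ger0_norm; lra.
case; first by rewrite divr_gt0 ?mulr_gt0 ?ltr_pwDr.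
move=> N _ /(_ N (leqnn N)); rewrite sub0r normrN ger0_norm ?exprn_ge0; try lra.
move=> hN; exists t, p, N; split=> //; first lra.
have : (1 - t) ^+ N * D <= kappa / 4.
  apply: (@le_trans _ _ (kappa / (4 * (D + 1)) * D)).
    by rewrite ler_wpM2r // ltW.
  rewrite -mulrA ler_wpM2l ?(ltW k0) // [leLHS]mulrC.
  by rewrite ler_pdivrMr ?mulr_gt0 ?ltr_pwDr //; lra.
lra.
Qed.

(** * Comparison of energies on two balls *)

Section Compare.
Context (R : realType) (d : nat) dX (X : measurableType dX)
  dL (L : measurableType dL).
Variables (S : spectral_space R d X L) (mu : {finite_measure set L -> \bar R}).
Hypothesis d_gt0 : (0 < d)%N.
Variables (k0 r : R).
Hypotheses (k0_ge0 : 0 <= k0) (r_ge0 : 0 <= r).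
Hypothesis ker_ge : forall x y, - (k0 * [forall j,
  (`|co S x ord0 j - co S y ord0 j| < r)%R]%:R) <= ker S mu x y.

Local Notation g := (pair_form mu).

Definition energy_of (nu : probability X R) : R :=
  g (fint nu (feature S)) (fint nu (feature S)).

(** The base scale [a] is the integer part of [T / M], where [M] makes the largest scale [a * p ^ N]
    admissible in [inward_in_ball]. It is still at least [T / (2 * M) = gamma * T], so it dominates
    [w], and its box dilutes the negative part of the kernel to order [T ^- d]. The condition with
    [C] says that the energy of [nu] dominates what is left. *)
Lemma energy_compare (kappa : R) : 0 < kappa -> exists gamma C T1 : R,
  [/\ 0 < gamma, 0 < T1 & forall T w (nu : probability X R),
    T1 <= T -> w <= gamma * T -> nu (ball S (T + w)) = 1%E ->
    k0 * C <= T ^+ d * energy_of nu ->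
    exists2 rho : probability X R, rho (ball S T) = 1%E &
      energy_of rho <= (1 + kappa) * energy_of nu].
Proof.
move=> kappa0; pose I : finType := ('I_d * bool)%type.
have [t [p [N [t01 p0 tpN]]]] :=
  banach_saks_parameters (2 * #|I|%:R) (6 * d ^ 2 + d)%N kappa0.
have [M [M0 ME]] : exists M : R, 0 < M /\ 14 * d%:R ^+ 3 * (p ^ N)%:R = M.
  exists (14 * d%:R ^+ 3 * (p ^ N)%:R); split=> //.
  by rewrite !mulr_gt0 ?exprn_gt0 ?ltr0n ?expn_gt0 ?p0.
exists (2 * M)^-1, ((#|I|%:R + #|I|%:R ^+ 2) * (2 * r + 1) ^+ d * (2 * M) ^+ d), M.
split=> // [|T w nu MT wT nuT CE]; first by rewrite invr_gt0 mulr_gt0.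
pose a := Num.truncn (T / M).
have T0 : 0 < T by exact: lt_le_trans MT.
have TM1 : 1 <= T / M by rewrite ler_pdivlMr // mul1r.
have aT : a%:R <= T / M by rewrite truncn_le; lra.
have a0 : (0 < a)%N by rewrite truncn_gt0.
have Ta : T / (2 * M) <= a%:R.
  have h1 : T / M < a.+1%:R by exact: truncnS_gt.
  have h2 : 1 <= a%:R :> R by rewrite ler1n.
  rewrite invfM mulrCA; move: h1; rewrite -natr1; lra.
have [c [mc cP]] := measurable_cells S d_gt0.
have := @transfer _ _ _ X _ L S mu d_gt0 nu a c a0 mc k0 r k0_ge0 r_ge0 ker_ge cP
  T w t p N p0.
case=> //.
- by apply: le_trans wT _; rewrite mulrC.
- by rewrite natrM mulrCA ME -ler_pdivlMr.
- rewrite card_box natrX -/(energy_of nu) mulrA.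
  have a0' : 0 < a%:R :> R by rewrite ltr0n.
  rewrite ler_pdivrMr ?exprn_gt0 //.
  have h : (T / (2 * M)) ^+ d * energy_of nu <= a%:R ^+ d * energy_of nu.
    rewrite ler_wpM2r ?ip_ge0 // lerXn2r ?nnegrE ?ler0n //.
    by rewrite divr_ge0 ?ltW // mulr_gt0.
  rewrite [leRHS]mulrC; apply: le_trans h.
  rewrite expr_div_n mulrAC ler_pdivlMr ?exprn_gt0 ?mulr_gt0 //.
  by apply: le_trans CE; rewrite le_eqVlt; apply/orP; left; apply/eqP; ring.
move=> _ [rho [rhoT ->]] h; exists rho => //.
by apply: le_trans h _; rewrite ler_wpM2r // ip_ge0.
Qed.

End Compare.

(** * Asymptotics of the capacity *)

Lemma integral_full dT (T : measurableType dT) (R : realType)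
    (P : probability T R) (D : set T) (f : T -> R) : measurable D ->
  P D = 1%E -> bounded_measurable f ->
  (\int[P]_(x in D) (f x)%:E = (\int[P]_x f x)%:E)%E.
Proof.
move=> mD PD bf.
have intf : P.-integrable setT (EFin \o f) by exact: bounded_measurable_integrableT.
rewrite /Rintegral fineK; last exact: integrable_fin_num.
have PDC : P (~` D) = 0%E by rewrite probability_setC // PD subee.
have := negligible_integral (measurableC mD) measurableT intf PDC.
by rewrite setDE setCK setTI => ->.
Qed.

Lemma powR_large (R : realType) (eps c : R) : 0 < eps ->
  exists2 T0 : R, 0 < T0 & forall T, T0 <= T -> c <= T `^ eps.
Proof.
move=> e0; pose b := Num.max c 1; have b0 : 0 < b by rewrite lt_max ltr01 orbT.
exists (b `^ eps^-1); first by rewrite powR_gt0.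
move=> T hT; apply: (@le_trans _ _ b); first by rewrite le_max lexx.
have -> : b = (b `^ eps^-1) `^ eps.
  by rewrite -powRrM mulVf ?gt_eqF // powRr1 // ltW.
apply: ge0_ler_powR => //; rewrite ?nnegrE ?powR_ge0 ?(ltW e0) //.
exact: le_trans (powR_ge0 _ _) hT.
Qed.

(** This is where the exponent [1 - eps] enters: the width is eventually below any fixed fraction of
    the radius. *)
Lemma powR_small (R : realType) (eps gamma : R) : 0 < eps -> 0 < gamma ->
  exists2 T0 : R, 0 < T0 & forall T, T0 <= T -> T `^ (1 - eps) <= gamma * T.
Proof.
move=> e0 g0; have [T0 T00 h] := powR_large gamma^-1 e0.
exists T0 => // T hT; have T1 : 0 < T by exact: lt_le_trans hT.
rewrite powRB; last by rewrite (gt_eqF T1) implybT.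
rewrite powRr1 ?(ltW T1) // mulrC ler_wpM2r ?(ltW T1) //.
by rewrite -[leRHS]invrK lef_pV2 ?h // posrE ?invr_gt0 ?powR_gt0.
Qed.

Section Capacity.
Context (R : realType) (d : nat) (X : ptopologicalType)
  dL (L : measurableType dL).
Variables (S : spectral_space R d (borel X) L)
  (mu : {finite_measure set L -> \bar R}).
Variable k : X -> X -> R.
Hypothesis kE : forall x y, k x y = ker S mu x y.

Local Notation g := (pair_form mu).
Local Notation ball := (ball S).
Local Notation energy_of := (energy_of S mu).

Lemma energyE (nu : probability (borel X) R) D : measurable (D : set (borel X)) ->
  nu D = 1%E -> energy k D nu = (energy_of nu)%:E.
Proof.
move=> mD nuD; rewrite /energy.
set Phi := sec (feature S); set F := fint nu (feature S).
have inner x : (\int[nu]_(y in D) (k x y)%:E = (g (Phi x) F)%:E)%E.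
  transitivity (\int[nu]_(y in D) (g (Phi y) (Phi x))%:E)%E.
    by apply: eq_integral => y _; rewrite kE /ker ipC.
  apply: etrans (integral_full mD nuD (bm_ip_sec mu (feature S) (Phi x))) _.
  by rewrite -fint_ipl ipC.
transitivity (\int[nu]_(x in D) (g (Phi x) F)%:E)%E.
  by apply: eq_integral => x _; exact: inner.
apply: etrans (integral_full mD nuD (bm_ip_sec mu (feature S) F)) _.
by rewrite -fint_ipl.
Qed.

Definition min_energy (T : R) : \bar R :=
  ereal_inf [set energy k (ball T) nu |
    nu in [set nu : probability (borel X) R | nu (ball T) = 1%E]].

Lemma min_energy_le T (nu : probability (borel X) R) : nu (ball T) = 1%E ->
  (min_energy T <= (energy_of nu)%:E)%E.
Proof.
move=> nuT; rewrite -(energyE (measurable_ball S T)) //.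
by apply: ereal_inf_lbound; exists nu.
Qed.

Lemma le_min_energy T (c : \bar R) :
  (forall nu : probability (borel X) R, nu (ball T) = 1%E ->
    (c <= (energy_of nu)%:E)%E) -> (c <= min_energy T)%E.
Proof.
move=> h; apply: le_ereal_inf_tmp => _ [nu nuT <-].
by rewrite energyE; [exact: h|exact: measurable_ball|].
Qed.

Lemma ball_mono (nu : probability (borel X) R) T T' : T <= T' ->
  nu (ball T) = 1%E -> nu (ball T') = 1%E.
Proof.
move=> TT' nuT; apply/eqP; rewrite eq_le probability_le1 /=;
  last exact: measurable_ball.
rewrite -nuT le_measure ?inE //; [exact: measurable_ball..|].
by move=> x /= /le_trans; exact.
Qed.

Lemma min_energy_mono T T' : T <= T' -> (min_energy T' <= min_energy T)%E.
Proof.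
move=> TT'; apply: le_min_energy => nu nuT; apply: min_energy_le.
exact: ball_mono nuT.
Qed.

Hypothesis d_gt0 : (0 < d)%N.
Variables (k0 r : R).
Hypotheses (k0_ge0 : 0 <= k0) (r_ge0 : 0 <= r).
Hypothesis ker_ge : forall x y, - (k0 * [forall j,
  (`|co S x ord0 j - co S y ord0 j| < r)%R]%:R) <= ker S mu x y.
Hypothesis energy_gt0 : exists T0 : R, forall T, T0 <= T ->
  exists2 c : R, 0 < c & forall nu : probability (borel X) R,
    nu (ball T) = 1%E -> c <= energy_of nu.
Hypothesis energy_large : forall C : R, exists T0 : R, forall T, T0 <= T ->
  forall nu : probability (borel X) R, nu (ball (2 * T)) = 1%E ->
    k0 * C <= T ^+ d * energy_of nu.

(** The Dirac mass at the origin gives finiteness and [energy_gt0] gives positivity, so that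
    capacities are positive reals and their quotient is an ordinary one. *)
Lemma min_energy_gt0 : exists2 T0 : R, 0 < T0 & forall T, T0 <= T ->
  exists2 c : R, 0 < c & min_energy T = c%:E.
Proof.
have [T0 h] := energy_gt0; exists (Num.max T0 1); first by rewrite lt_max ltr01 orbT.
move=> T; rewrite ge_max => /andP[/h[c c0 hc] T1].
have : (min_energy T <= (energy_of \d_(orig S : borel X))%:E)%E.
  apply: min_energy_le; rewrite /= /dirac indicE mem_set //.
  by rewrite /ball /= co_orig enorm0 (le_trans ler01).
have : (c%:E <= min_energy T)%E by apply: le_min_energy => nu /hc; rewrite lee_fin.
case: (min_energy T) => [e|//|//]; rewrite !lee_fin => ce _.
by exists e => //; exact: lt_le_trans ce.
Qed.

Lemma min_energy_compare (kappa : R) : 0 < kappa -> exists gamma T1 : R,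
  [/\ 0 < gamma, 0 < T1 & forall T w, T1 <= T -> w <= gamma * T ->
    (min_energy T <= (1 + kappa)%:E * min_energy (T + w))%E].
Proof.
move=> kappa0.
have [gamma [C [T1 [g0 T10 h]]]] := energy_compare d_gt0 k0_ge0 r_ge0 ker_ge kappa0.
have [T2 hT2] := energy_large C.
(* The cap [1] gives [T + w <= 2 * T], the radius for which [energy_large] is stated. *)
exists (Num.min gamma 1), (Num.max T1 T2); split.
- by rewrite lt_min g0 ltr01.
- by rewrite lt_max T10.
move=> T w; rewrite ge_max => /andP[T1T T2T] wT.
have T0 : 0 < T by exact: lt_le_trans T1T.
have kp : 0 < 1 + kappa by rewrite addr_gt0.
rewrite -lee_pdivrMl //; apply: le_min_energy => nu nuT.
rewrite lee_pdivrMl // -EFinM.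
have [| |rho rhoT rho_le] := h T w nu T1T _ nuT.
- by apply: le_trans wT _; rewrite ler_wpM2r ?(ltW T0) // ge_min lexx.
- apply: hT2 => //; apply: ball_mono nuT.
  have : w <= 1 * T.
    by apply: le_trans wT _; rewrite ler_wpM2r ?(ltW T0) // ge_min lexx orbT.
  lra.
by apply: (le_trans (min_energy_le rhoT)); rewrite lee_fin.
Qed.

(** The quotient of the capacities is the inverse quotient of the minimal energies: it is at least
    [1] by monotonicity and at most [1 + kappa] by [min_energy_compare]. *)
Lemma capacity_asymp (eps : R) : 0 < eps ->
  asymp_equiv (fun T => capacity k (ball (T + T `^ (1 - eps))))
              (fun T => capacity k (ball T)).
Proof.
move=> e0; have [T0 T00 hpos] := min_energy_gt0.
apply/fine_cvgP; suff key (kappa : R) : 0 < kappa -> exists2 T1 : R, 0 < T1 &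
    forall T, T1 <= T -> exists2 q : R, 1 <= q <= 1 + kappa &
      (capacity k (ball (T + T `^ (1 - eps))) / capacity k (ball T))%E = q%:E.
  split.
    have [T1 _ h] := key 1 ltr01.
    near=> T; have [|q _ ->//] := h T.
    by near: T; apply: nbhs_pinfty_ge; exact: num_real.
  apply/cvgrPdist_le => kappa kappa0; have [T1 _ h] := key kappa kappa0.
  near=> T; have [|q /andP[q1 qk] E] := h T.
    by near: T; apply: nbhs_pinfty_ge; exact: num_real.
  by rewrite /= E /= distrC ger0_norm ?subr_ge0 // lerBlDl.
move=> kappa0; have [gamma [T1 [g0 T10 h]]] := min_energy_compare kappa0.
have [T2 T20 h2] := powR_small e0 g0.
exists (Num.max T0 (Num.max T1 T2)); first by rewrite lt_max T00.
move=> T; rewrite !ge_max => /and3P[T0T T1T T2T].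
set w := T `^ (1 - eps); have w0 : 0 <= w by exact: powR_ge0.
have [c c0 cE] := hpos T T0T.
have [|c' c'0 c'E] := hpos (T + w); first by rewrite (le_trans T0T) // lerDl.
have capE T' : capacity k (ball T') = ((min_energy T')^-1)%E by [].
rewrite !capE cE c'E.
rewrite !inver !gt_eqF // inver gt_eqF ?invr_gt0 // invrK -EFinM.
exists (c'^-1 * c) => //; rewrite mulrC ler_pdivlMr // mul1r ler_pdivrMr //.
have := min_energy_mono (_ : T <= T + w); rewrite cE c'E lee_fin lerDl w0 => -> //=.
by have := h T w T1T (h2 T T2T); rewrite cE c'E -EFinM lee_fin.
Unshelve. all: by end_near. Qed.

End Capacity.

(** * Lower bounds for the energy *)

Lemma cos_near0 (R : realType) : exists2 eta : R, 0 < eta &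
  forall t : R, `|t| <= eta -> 1 / 2 <= cos t.
Proof.
have /cvgrPdist_lt/(_ (1 / 2)) := @continuous_cos R 0.
case; first by [].
move=> e /= e0 he; exists (e / 2); first by rewrite divr_gt0.
move=> t te; have : `|cos 0 - cos t| < 1 / 2.
  by apply: he; rewrite /ball_ /= sub0r normrN; lra.
by rewrite cos0; have := ler_norm (1 - cos t); lra.
Qed.

Section Positivity.
Context (R : realType) (d : nat) dX (X : measurableType dX)
  dL (L : measurableType dL).
Variables (S : spectral_space R d X L) (mu : {finite_measure set L -> \bar R}).

Local Notation g := (pair_form mu).
Local Notation ball := (ball S).
Local Notation co := (co S).
Local Notation fr := (fr S).
Local Notation ker := (ker S mu).
Local Notation energy_of := (energy_of S mu).

(** * Positive energy from a cover by cubes *)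

Section Cover.
Variables (rho c : R).
Hypotheses (rho_gt0 : 0 < rho) (c_gt0 : 0 < c).
Hypothesis ker_ge0 : forall x y, 0 <= ker x y.
Hypothesis ker_diag : forall x y,
  (forall j, `|co x ord0 j - co y ord0 j| < rho) -> c <= ker x y.

Lemma energy_ge_cube (nu : probability X R) (A : set X) : measurable A ->
  (forall x y, A x -> A y -> forall j, `|co x ord0 j - co y ord0 j| < rho) ->
  c * (\int[nu]_x \1_A x) ^+ 2 <= energy_of nu.
Proof.
move=> mA Arho; rewrite /energy_of fint_ip; set m := Rintegral _ _ _.
have b1 := bounded_measurable_indic R mA.
have -> : c * m ^+ 2 = \int[nu]_x (c * m * \1_A x).
  by rewrite RintegralZ_bm // -/m; ring.
apply: le_Rintegral_bm => [||x].
- exact: bounded_measurableM (bounded_measurable_cst _ _) b1.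
- exact: bm_ip_sec_fint.
have -> : c * m * \1_A x = \int[nu]_y (c * \1_A x * \1_A y).
  by rewrite RintegralZ_bm // -/m; ring.
apply: le_Rintegral_bm => [||y].
- exact: bounded_measurableM (bounded_measurable_cst _ _) b1.
- have -> : (fun y => g (sec (feature S) x) (sec (feature S) y)) =
    (fun y => g (sec (feature S) y) (sec (feature S) x)).
    by apply/funext => y; exact: ipC.
  exact: bm_ip_sec.
rewrite -/(ker x y) !indicE.
case: (boolP (x \in A)) => [/set_mem Ax|_]; last by rewrite mulr0 mul0r.
case: (boolP (y \in A)) => [/set_mem Ay|_]; last by rewrite !mulr0.
by rewrite !mulr1; apply: ker_diag => j; exact: Arho.
Qed.

(** Pigeonhole: finitely many cubes of side [rho] cover the ball, so one of them has mass at least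
    the inverse of their number. The kernel is at least [c] inside this cube and non-negative
    elsewhere. *)
Lemma energy_gt0_cover : exists T0 : R, forall T, T0 <= T ->
  exists2 c' : R, 0 < c' & forall nu : probability X R,
    nu (ball T) = 1%E -> c' <= energy_of nu.
Proof.
(* Along each axis, [n] half-open intervals of length [rho] starting at [- T] cover [[- T, T]]. *)
exists 0 => T T0; pose n := (Num.truncn (2 * T / rho)).+1.
pose J := {ffun 'I_d -> 'I_n}.
have J0 : (0 < #|{: J}|)%N by rewrite card_box expn_gt0.
pose A (f : J) : set X := [set x | forall j,
  (f j)%:R * rho <= co x ord0 j + T < (f j)%:R * rho + rho].
have mA f : measurable (A f).
  have -> : A f = \bigcap_(j in [set: 'I_d])
      [set x | (f j)%:R * rho <= co x ord0 j + T < (f j)%:R * rho + rho].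
    by apply/seteqP; split=> x Ax j; [move=> _; exact: Ax|exact: Ax].
  apply: fin_bigcap_measurable => // j _.
  have h : measurable_fun setT (fun x => co x ord0 j + T).
    by apply: measurable_funD; [exact: measurable_co|exact: measurable_cst].
  have := measurable_and (measurable_fun_ler (measurable_cst ((f j)%:R * rho)) h)
    (measurable_fun_ltr h (measurable_cst ((f j)%:R * rho + rho))).
  by move/(_ measurableT [set true] Logic.I); rewrite setTI preimage_true.
exists (c * (#|{: J}|%:R^-1) ^+ 2).
  by rewrite mulr_gt0 // exprn_gt0 // invr_gt0 ltr0n.
move=> nu nuT.
have sum1 : 1 <= \sum_(f : J) \int[nu]_x (\1_(A f) x : R).
  rewrite -Rintegral_sum_bm; last by move=> f; exact: bounded_measurable_indic.
  have bs : bounded_measurable (fun x => \sum_(f : J) (\1_(A f) x : R)).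
    by apply: bounded_measurable_sum => f; exact: bounded_measurable_indic.
  have mB := measurable_ball S T.
  rewrite -lee_fin -(integral_full mB nuT bs).
  have -> : 1%:E = (\int[nu]_(x in ball T) (cst 1%:E) x)%E.
    by rewrite integral_cst // mul1e.
  apply: ge0_le_integral => //.
  - by apply/measurable_EFinP; apply: measurable_funTS; case: bs.
  move=> x xT; rewrite lee_fin.
  have cx j : 0 <= (co x ord0 j + T) / rho < n%:R.
    have := le_trans (abs_coord_le (co x) j) xT; rewrite ler_norml => /andP[h1 h2].
    apply/andP; split; first by rewrite divr_ge0 ?(ltW rho_gt0) //; lra.
    apply: le_lt_trans (truncnS_gt (2 * T / rho)).
    by rewrite ler_pM2r ?invr_gt0 //; lra.
  have tx : forall i, (Num.truncn ((co x ord0 i + T) / rho) < n)%N.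
    move=> i; have /andP[h1 h2] := cx i.
    by rewrite -(ltr_nat R); apply: le_lt_trans h2; rewrite truncn_le.
  rewrite (bigD1 [ffun j => Ordinal (tx j)]) //= indicE mem_set.
    by rewrite lerDl sumr_ge0.
  move=> j; rewrite ffunE /=; have /andP[h1 h2] := cx j.
  apply/andP; split; first by rewrite -ler_pdivlMr // truncn_le.
  rewrite -[X in _ < _ + X]mul1r -[ltRHS]mulrDl -ltr_pdivrMr // natr1.
  exact: truncnS_gt.
have [f hf] : exists f : J, #|{: J}|%:R^-1 <= \int[nu]_x (\1_(A f) x : R).
  apply: contrapT => /forallNP h.
  have : \sum_(f : J) \int[nu]_x (\1_(A f) x : R) < 1.
    apply: (@lt_le_trans _ _ (\sum_(f : J) #|{: J}|%:R^-1)).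
      have [f0 _] := card_gt0P J0.
      rewrite [ltLHS](bigD1 f0) //= [ltRHS](bigD1 f0) //=; apply: ltr_leD.
        by rewrite ltNge; apply/negP; exact: h.
      by apply: ler_sum => f _; apply: ltW; rewrite ltNge; apply/negP; exact: h.
    by rewrite sumr_const -[leLHS]mulr_natl divff // pnatr_eq0 -lt0n.
  by move=> /(le_lt_trans sum1); rewrite ltxx.
apply: le_trans (@energy_ge_cube nu (A f) (mA f) _).
  rewrite ler_wpM2l ?(ltW c_gt0) // lerXn2r ?nnegrE ?invr_ge0 ?ler0n //.
  exact: le_trans hf.
move=> x y Ax Ay j; have /andP[x1 x2] := Ax j; have /andP[y1 y2] := Ay j.
rewrite ltr_norml; apply/andP; split; lra.
Qed.

End Cover.

(** * Lower bounds from the low frequencies *)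

Section LowFrequencies.
Variables (beta delta0 : R).
Hypotheses (delta0_gt0 : 0 < delta0) (beta_lt_d : beta < d%:R).
Hypothesis low : forall delta, 0 < delta < delta0 -> exists A : set L,
  [/\ measurable A, delta `^ beta <= \int[mu]_l \1_A l &
    forall l, A l -> exists2 y : 'rV[R]_d, enorm y <= delta &
      forall x, cos (phase (fr l) (co x)) = cos (phase y (co x))].

(* The transform of a measure on the ball of radius [T] is at least [1 / 2] at
   frequencies which are small compared to [1 / T]. *)
Lemma energy_low : exists2 c : R, 0 < c & exists2 T0 : R, 0 < T0 &
  forall T, T0 <= T -> forall nu : probability X R, nu (ball T) = 1%E ->
    c * T `^ (- beta) <= energy_of nu.
Proof.
have [eta eta0 etaP] := cos_near0 R.
have pi0 : 0 < 2 * pi :> R by rewrite mulr_gt0 // pi_gt0.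
(* With this [q], a frequency of norm at most [q / T] has phase at most [eta] in absolute value on
   the ball of radius [T]. The factor [2] in the threshold below makes [q / T < delta0] strict. *)
pose q := eta / (2 * pi); have q0 : 0 < q by rewrite divr_gt0.
exists (1 / 4 * q `^ beta); first by rewrite mulr_gt0 ?powR_gt0.
exists (2 * (q / delta0)); first by rewrite mulr_gt0 ?divr_gt0.
move=> T hT nu nuT.
have T0 : 0 < T by apply: lt_le_trans hT; rewrite mulr_gt0 ?divr_gt0.
have [|A [mA muA Acos]] := low (delta := q / T).
  rewrite divr_gt0 //= ltr_pdivrMr // mulrC -ltr_pdivrMr //.
  by apply: lt_le_trans hT; rewrite ltr_pMl ?divr_gt0 // ltr1n.
have qE : q `^ beta * T `^ (- beta) = (q / T) `^ beta.
  rewrite powRM ?(ltW q0) ?invr_ge0 ?(ltW T0) //.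
  by rewrite -(powR_inv1 (ltW T0)) -powRrM mulN1r.
rewrite -[leLHS]mulrA qE; apply: (@le_trans _ _ (\int[mu]_l (1 / 4 * \1_A l))).
  rewrite RintegralZ_bm; last exact: bounded_measurable_indic.
  by rewrite ler_wpM2l.
set h := fint nu (feature S); rewrite /energy_of -/h.
apply: le_Rintegral_bm => [||l].
- exact: bounded_measurableM (bounded_measurable_cst _ _) (bounded_measurable_indic R mA).
- exact: (bm_pair h h).
rewrite indicE; case: (boolP (l \in A)) => [/set_mem Al|_]; last first.
  by rewrite mulr0 -!expr2 addr_ge0 ?sqr_ge0.
suff h1 : 1 / 2 <= h.1 l.
  rewrite mulr1 -!expr2; apply: (@le_trans _ _ (h.1 l ^+ 2)).
    have : (1 / 2) ^+ 2 <= h.1 l ^+ 2 by rewrite lerXn2r ?nnegrE //; lra.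
    lra.
  by rewrite lerDl sqr_ge0.
have bc := bm_section1 (bm_cos_phase S) l.
rewrite /h /= -lee_fin -(integral_full (measurable_ball S T) nuT bc).
have -> : (1 / 2 : R)%:E = (\int[nu]_(x in ball T) (cst (1 / 2 : R)%:E) x)%E.
  rewrite integral_cst //; last exact: measurable_ball.
  by transitivity ((1 / 2 : R)%:E * 1%E)%E; [rewrite mule1|congr (_ * _)%E].
have [y yq ycos] := Acos l Al.
have cge x : ball T x -> 1 / 2 <= cos (phase (fr l) (co x)).
  move=> xT; rewrite ycos; apply: etaP; rewrite /phase normrM.
  rewrite (ger0_norm (ltW pi0)) mulrC -ler_pdivlMr //.
  apply: le_trans (dot_le_enorm _ _) _.
  have -> : eta / (2 * pi) = q / T * T by rewrite divfK // gt_eqF.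
  by rewrite ler_pM ?enorm_ge0.
apply: ge0_le_integral => //.
- exact: measurable_ball.
- by move=> x _; rewrite lee_fin.
- by apply/measurable_EFinP; apply: measurable_funTS; case: bc.
Qed.

Lemma energy_gt0_low : exists T0 : R, forall T, T0 <= T ->
  exists2 c' : R, 0 < c' & forall nu : probability X R,
    nu (ball T) = 1%E -> c' <= energy_of nu.
Proof.
have [c c0 [T0 T00 h]] := energy_low; exists T0 => T hT.
exists (c * T `^ (- beta)); last exact: h.
by rewrite mulr_gt0 // powR_gt0 //; exact: lt_le_trans hT.
Qed.

(** By [energy_low] the right-hand side is at least a multiple of [T ^ (d - beta)], which is
    unbounded since [beta < d]. *)
Lemma energy_large_low (C : R) : exists T0 : R, forall T, T0 <= T ->
  forall nu : probability X R, nu (ball (2 * T)) = 1%E ->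
    C <= T ^+ d * energy_of nu.
Proof.
have [c c0 [T0 T00 h]] := energy_low.
have db : 0 < d%:R - beta by rewrite subr_gt0.
pose c2 := c * 2 `^ (- beta).
have c20 : 0 < c2 by rewrite mulr_gt0 // powR_gt0.
have [T1 T10 h1] := powR_large (C / c2) db.
exists (Num.max T0 T1) => T; rewrite ge_max => /andP[hT0 hT1] nu nuT.
have T2 : 0 < T by exact: lt_le_trans hT0.
have := h (2 * T) _ nu nuT; rewrite (le_trans hT0) ?ler_peMl ?(ltW T2) ?ler1n //.
move=> /(_ isT) E; apply: (@le_trans _ _ (T ^+ d * (c * (2 * T) `^ (- beta)))).
  rewrite powRM ?(ltW T2) //.
  rewrite (_ : _ * (c * _) = c2 * (T ^+ d * T `^ (- beta))); last first.
    by rewrite /c2; ring.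
  rewrite -powR_mulrn ?(ltW T2) // -powRD ?(gt_eqF T2) ?implybT //.
  by have := h1 T hT1; rewrite ler_pdivrMr // mulrC.
by rewrite ler_wpM2l // exprn_ge0 // ltW.
Qed.

End LowFrequencies.

End Positivity.

(** For small [delta] the quotient is below [beta]; multiplying by the negative number [ln delta]
    turns this into a lower bound on the mass. *)
Lemma log_exponent_low (R : realType) (mB : R -> \bar R) (alpha : \bar R)
    (beta : R) : log_exponent mB alpha -> (alpha < beta%:E)%E ->
  exists2 delta0 : R, 0 < delta0 & forall delta, 0 < delta < delta0 ->
    ((delta `^ beta)%:E <= mB delta)%E.
Proof.
move=> h ab.
have [e /= e0 he] := h [set u | (u < beta%:E)%E] (open_ereal_lt' ab).
exists (Num.min e 1); first by rewrite lt_min e0 ltr01.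
move=> delta /andP[d0]; rewrite lt_min => /andP[de d1].
have ld : ln delta < 0 by rewrite ln_lt0 // d0.
have := he delta _ d0; rewrite /ball_ /= sub0r normrN ger0_norm ?(ltW d0) //.
move=> /(_ de); rewrite inver lt_eqF //.
case E : (mB delta) => [m| |] //=; last first.
- by rewrite mulNyr ltr0_sg ?invr_lt0 // mulN1e.
- by rewrite leey.
(* A value [m <= 0] has [lne] equal to [-oo]; dividing by [ln delta < 0] gives [+oo], which is not
   below [beta]. *)
case: ifPn => [_|]; first by rewrite mulNyr ltr0_sg ?invr_lt0 // mulN1e.
rewrite -ltNge => m0; rewrite -EFinM lte_fin ltr_ndivrMr // => hm.
by rewrite lee_fin ltW // -ltr_ln ?posrE ?powR_gt0 // ln_powR.
Qed.

(** * The kernel near the diagonal *)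

Section Diagonal.
Context (R : realType) (d : nat) dX (X : measurableType dX)
  dL (L : measurableType dL).
Variables (S : spectral_space R d X L) (mu : {finite_measure set L -> \bar R}).

Local Notation co := (co S).
Local Notation fr := (fr S).
Local Notation ker := (ker S mu).

Lemma bm_cos_diff x y :
  bounded_measurable (fun l => cos (phase (fr l) (co x - co y))).
Proof.
have -> : (fun l => cos (phase (fr l) (co x - co y))) =
    (fun l => cos (phase (fr l) (co x)) * cos (phase (fr l) (co y)) +
              sin (phase (fr l) (co x)) * sin (phase (fr l) (co y))).
  by apply/funext => l; rewrite phaseB cosB.
by apply: bounded_measurableD; apply: bounded_measurableM;
  [exact: (bm_section2 (bm_cos_phase S))..|
   exact: (bm_section2 (bm_sin_phase S))|exact: (bm_section2 (bm_sin_phase S))].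
Qed.

Lemma ker_ge_mass x y : - fine (mu setT) <= ker x y.
Proof.
rewrite kerE -mulN1r -Rintegral_cst //.
apply: le_Rintegral_bm => [||l /=]; last exact: cos_geN1.
- exact: bounded_measurable_cst.
- exact: bm_cos_diff.
Qed.

Lemma ker_diag_near : 0 < fine (mu setT) -> exists2 rho : R, 0 < rho &
  forall x y, (forall j, `|co x ord0 j - co y ord0 j| < rho) ->
    fine (mu setT) / 2 <= ker x y.
Proof.
move=> m0; apply: contrapT => /forall2NP h.
have {}h n : exists xy : X * X,
    (forall j, `|co xy.1 ord0 j - co xy.2 ord0 j| < n.+1%:R^-1) /\
    ker xy.1 xy.2 < fine (mu setT) / 2.
  have [|/existsNP[x /existsNP[y /not_implyP[xy k]]]] := h n.+1%:R^-1.
    by rewrite invr_gt0 ltr0n.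
  by exists (x, y); split=> //; rewrite ltNge; apply/negP.
have {h} [f fP] := choice h.
pose c n l := cos (phase (fr l) (co (f n).1 - co (f n).2)).
have cvg1 l : (c n l)%:E @[n --> \oo] --> (1 : R)%:E.
  apply: cvg_EFin; first exact: nearW.
  rewrite -(@cos0 R); apply: continuous_cvg; first exact: continuous_cos.
  pose C := 2 * pi * enorm (fr l) * d%:R.
  have C0 : C * n.+1%:R^-1 @[n --> \oo] --> 0.
    by rewrite -(mulr0 C); apply: cvgMr; exact: cvg_harmonic.
  apply/norm_cvg0P; apply: squeeze_cvgr C0; last exact: cvg_cst.
  apply: nearW => n; rewrite normr_ge0 /= /phase normrM.
  rewrite ger0_norm ?mulr_ge0 ?pi_ge0 // /C -!mulrA ler_wpM2l //.
  rewrite ler_wpM2l ?pi_ge0 //; apply: le_trans (dot_le_enorm _ _) _.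
  rewrite ler_wpM2l ?enorm_ge0 //; apply: enorm_le_max => j.
  by rewrite !mxE ltW // (fP n).1.
have : (\int[mu]_l (c n l)%:E)%E @[n --> \oo] --> (\int[mu]_l (1 : R)%:E)%E.
  apply: (@dominated_cvg _ _ _ mu setT measurableT
    (fun n l => (c n l)%:E) (cst 1%:E) (cst 1%:E)) => //.
  - by move=> n; apply/measurable_EFinP; case: (bm_cos_diff (f n).1 (f n).2).
  - exact: (bounded_measurable_integrable _ measurableT (bounded_measurable_cst _ 1)).
  - by move=> n l _; rewrite lee_fin cos_max.
have -> : (\int[mu]_l (1 : R)%:E = (fine (mu setT))%:E)%E.
  rewrite -[LHS]/(integral mu setT (cst 1%:E)) integral_cst // mul1e.
  by rewrite fineK ?fin_num_measure.
move=> /fine_cvg/cvgrPdist_lt/(_ (fine (mu setT) / 2)).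
case; first by rewrite divr_gt0.
move=> n _ /(_ n (leqnn n)) /=.
rewrite (_ : fine (\int[mu]_l (c n l)%:E)%E = ker (f n).1 (f n).2);
  last by rewrite kerE.
by have [_] := fP n; rewrite ltr_norml => h1 /andP[h2 h3]; lra.
Qed.

End Diagonal.

(** * The two sets of hypotheses *)

Section Conclusion.
Context (R : realType) (d : nat) (X : ptopologicalType)
  dL (L : measurableType dL).
Variables (S : spectral_space R d (borel X) L)
  (mu : {finite_measure set L -> \bar R}).
Variable k : X -> X -> R.
Hypothesis kE : forall x y, k x y = ker S mu x y.
Hypothesis d_gt0 : (0 < d)%N.

(** For a non-negative kernel, [k0 = 0] makes the growth condition trivial and the cover by cubes
    gives positive energies. Otherwise [k0] is the total mass, which bounds the kernel from below by
    [- k0], and the low frequencies give both positivity and growth. *)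
Theorem capacity_asymp_cases (eps : R) : 0 < eps ->
  (0 < fine (mu setT) /\ forall x y, 0 <= k x y) \/
  ((exists r : R, forall x y, r <= enorm (co S x - co S y) -> 0 <= k x y) /\
   exists beta delta0 : R, [/\ 0 < delta0, beta < d%:R &
     forall delta, 0 < delta < delta0 -> exists A : set L,
      [/\ measurable A, delta `^ beta <= \int[mu]_l \1_A l &
      forall l, A l -> exists2 y : 'rV[R]_d, enorm y <= delta &
      forall x, cos (phase (fr S l) (co S x)) = cos (phase y (co S x))]]) ->
  asymp_equiv (fun T => capacity k (ball S (T + T `^ (1 - eps))))
              (fun T => capacity k (ball S T)).
Proof.
move=> eps0 [[m0 kpos]|[[r hr] [beta [delta0 [delta0_gt0 beta_lt low]]]]].
  have kerpos x y : 0 <= ker S mu x y by rewrite -kE.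
  apply: (capacity_asymp kE d_gt0 (k0 := 0) (r := 0)) => //.
  - by move=> x y; rewrite mul0r oppr0.
  - have [rho rho0 h] := ker_diag_near S m0.
    by apply: (energy_gt0_cover rho0 _ kerpos h); rewrite divr_gt0.
  - move=> C; exists 0 => T T0 nu _; rewrite mul0r mulr_ge0 ?exprn_ge0 //.
    exact: ip_ge0.
have m0 : 0 <= fine (mu setT) by rewrite fine_ge0.
apply: (capacity_asymp kE d_gt0 (k0 := fine (mu setT)) (r := Num.max r 0)) => //.
- by rewrite le_max lexx orbT.
- move=> x y; have := ker_ge_mass S mu x y.
  case: (boolP [forall j, _]) => [_|]; first by rewrite mulr1.
  rewrite negb_forall => /existsP[j]; rewrite -leNgt ge_max => /andP[rj _] _.
  rewrite mulr0 oppr0 -kE; apply: hr; apply: le_trans rj _.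
  (* A single coordinate difference of size at least [r] already makes the Euclidean distance at
     least [r]. *)
  by have := abs_coord_le (co S x - co S y) j; rewrite !mxE.
- exact: energy_gt0_low delta0_gt0 low.
- by move=> C; exact: energy_large_low delta0_gt0 beta_lt low _.
Qed.

End Conclusion.

(** * Euclidean space, the lattice and the torus *)

Section Borel.
Context (R : realType).

Lemma measurable_borel_open (T : ptopologicalType) (A : set T) :
  open A -> measurable (A : set (borel T)).
Proof. exact: sub_sigma_algebra. Qed.

Lemma continuous_borel (T U : ptopologicalType) (f : T -> U) : continuous f ->
  measurable_fun setT (f : borel T -> borel U).
Proof.
move=> /continuousP cf.
apply: (@measurability _ _ (borel T) (borel U) setT f (@open U) erefl).
move=> _ [B oB <-].
by rewrite setTI; apply: measurable_borel_open; exact: cf.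
Qed.

Lemma continuous_borelR (T : ptopologicalType) (f : T -> R) : continuous f ->
  measurable_fun setT (f : borel T -> R).
Proof.
move=> /continuousP cf.
apply: (@measurability _ _ (borel T) R setT f _ (RGenOpens.measurableE R)).
move=> _ [B [a [b ->]] <-]; rewrite setTI; apply: measurable_borel_open.
exact/cf/interval_open.
Qed.

End Borel.

Section EuclideanSpace.
Context (R : realType) (d : nat).
Local Notation E := (borel 'rV[R]_d).

Lemma measurable_coord j : measurable_fun setT (fun x : E => x ord0 j : R).
Proof. by apply: continuous_borelR; exact: coord_continuous. Qed.

Lemma measurable_phase : measurable_fun setT (fun z : E * E => phase z.1 z.2 : R).
Proof.
apply: measurable_funM; first exact: measurable_cst.
apply: measurable_sum => j; apply: measurable_funM.
  exact: measurableT_comp (measurable_coord j) measurable_fst.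
exact: measurableT_comp (measurable_coord j) measurable_snd.
Qed.

Lemma measurable_translate (c : 'rV[R]_d) :
  measurable_fun setT (fun x : E => (x + c : E)).
Proof.
apply: (@continuous_borel 'rV[R]_d 'rV[R]_d (fun x => x + c)) => x.
apply: cvgD; [exact: (nbhs_filter x)|exact: cvg_id|].
by apply: (@cvg_cst 'rV[R]_d c 'rV[R]_d (nbhs x) (nbhs_filter x)).
Qed.

Definition euclidean_space : spectral_space R d E E :=
  @SpectralSpace R d _ E _ E id id (fun m x => x + of_lattice m) 0 erefl
    (fun m x => erefl) measurable_coord
    (fun m => measurable_translate (of_lattice m))
    (measurableT_comp (continuous_measurable_fun (@continuous_cos R)) measurable_phase)
    (measurableT_comp (continuous_measurable_fun (@continuous_sin R)) measurable_phase).

Lemma opp_phaseE (l x : 'rV[R]_d) : - 2 * pi * dot l x = - phase l x.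
Proof. by rewrite /phase; ring. Qed.

Lemma spectral_Rd_ker (K : 'rV[R]_d -> R)
    (mu : {finite_measure set E -> \bar R}) : spectral_measure_Rd K mu ->
  forall x y, K (x - y) = ker euclidean_space mu x y.
Proof.
case=> _ h x y; have /(congr1 (@complex.Re R)) := h (x - y).
rewrite kerE /= => ->; apply: eq_Rintegral => l _.
by rewrite opp_phaseE cosN.
Qed.

Lemma eball_low (alpha : \bar R) (beta : R)
    (mu : {finite_measure set E -> \bar R}) :
  log_exponent (fun delta => mu (eball delta)) alpha -> (alpha < beta%:E)%E ->
  exists2 delta0 : R, 0 < delta0 & forall delta, 0 < delta < delta0 ->
    exists A : set E, [/\ measurable A, delta `^ beta <= \int[mu]_l \1_A l &
      forall l, A l -> exists2 y : 'rV[R]_d, enorm y <= delta &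
      forall x, cos (phase (fr euclidean_space l) (co euclidean_space x)) =
                cos (phase y (co euclidean_space x))].
Proof.
move=> h /(log_exponent_low h)[delta0 d0 hd]; exists delta0 => // delta /hd muE.
have mA : measurable (eball delta : set E) by exact: measurable_ball euclidean_space _.
exists (eball delta); split=> //; last by move=> l Al; exists l.
rewrite -lee_fin; apply: le_trans muE _.
rewrite /Rintegral integral_indic // setIT fineK //; exact: fin_num_measure.
Qed.

End EuclideanSpace.

(** * Lattice positions and torus frequencies *)

Section Lattice.
Local Open Scope quotient_scope.
Context (R : realType) (d : nat).
Local Notation V := 'rV[R]_d.
Local Notation Z := (borel (lattice_space d)).
Local Notation T := (borel (torus R d)).
Implicit Types (x y : V) (m n : 'rV[int]_d).

Lemma periodic_int (f : R -> R) (p : R) (m : int) : periodic f p ->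
  forall a, f (a + p *~ m) = f a.
Proof.
move=> fp a; case: m => k; first exact: periodicn.
by rewrite NegzE mulrNz -[in LHS](periodicn fp k.+1) -addrA addNr addr0.
Qed.

(** Equivalent frequencies differ by an integer vector, whose product with [n] is an integer. *)
Lemma phase_lattice_eq x y n : lattice_eq x y ->
  exists m : int, phase x (of_lattice n) = phase y (of_lattice n) + (pi *+ 2) *~ m.
Proof.
move=> /forallP xy.
have /intrP[m mE] : dot (x - y) (of_lattice n) \is a Num.int.
  by apply: rpred_sum => i _; rewrite !mxE rpredM ?intr_int.
exists m; rewrite -mulrzr -mE /phase dotC [dot y _]dotC [dot (x - y) _]dotC dotBr.
by rewrite -mulr_natl; ring.
Qed.

Lemma cos_phase_lattice x y n : lattice_eq x y ->
  cos (phase x (of_lattice n)) = cos (phase y (of_lattice n)).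
Proof.
by move=> /(phase_lattice_eq n)[m ->]; rewrite periodic_int //; exact: cosD2pi.
Qed.

Lemma sin_phase_lattice x y n : lattice_eq x y ->
  sin (phase x (of_lattice n)) = sin (phase y (of_lattice n)).
Proof.
by move=> /(phase_lattice_eq n)[m ->]; rewrite periodic_int //; exact: sinD2pi.
Qed.

Lemma continuous_phase y : continuous (fun x => phase x y).
Proof.
move=> x; apply: (@continuousM _ _ (cst (2 * pi)) (fun z => dot z y)).
  exact: cst_continuous.
apply: (continuous_big (op := +%R)) => [|i _ z].
  exact: add_continuous.
apply: (@continuousM _ _ (fun z : V => z ord0 i) (cst (y ord0 i))).
  exact: coord_continuous.
exact: cst_continuous.
Qed.

Lemma torus_pi_eq x y : \pi_(torus R d) x = \pi_(torus R d) y -> lattice_eq x y.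
Proof. by move=> h; apply/(@eqmodP _ (lattice_eq_canonical R d)). Qed.

(** [repr] picks arbitrary representatives, but a continuous function that ignores the choice
    descends to a continuous function on the quotient. *)
Lemma measurable_torus_fun (g : R -> R) n : continuous g ->
  (forall x y, lattice_eq x y ->
    g (phase x (of_lattice n)) = g (phase y (of_lattice n))) ->
  measurable_fun setT (fun q : T => g (phase (repr (q : torus R d)) (of_lattice n))).
Proof.
move=> cg gE; apply: (@continuous_borelR R (torus R d)).
apply: (repr_comp_continuous (g := fun x => g (phase x (of_lattice n)))).
  move=> x; apply: continuous_comp; [exact: continuous_phase|exact: cg].
by move=> x y /eqP/torus_pi_eq/gE ->.
Qed.

Lemma measurable_lattice (A : set Z) : measurable A.
Proof. by apply: measurable_borel_open; exact: discrete_open. Qed.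

Lemma measurable_lattice_fun dY (Y : measurableType dY) (h : Z -> Y) :
  measurable_fun setT h.
Proof. by move=> _ B _; exact: measurable_lattice. Qed.

(** The lattice is countable, so the preimage is a countable union of its slices. *)
Lemma measurable_torus_lattice (h : T -> 'rV[int]_d -> R) :
  (forall n, measurable_fun setT (h ^~ n)) ->
  measurable_fun setT (fun z : T * Z => h z.1 z.2).
Proof.
move=> mh _ B mB; rewrite setTI.
have -> : (fun z : T * Z => h z.1 z.2) @^-1` B =
    \bigcup_(n : 'rV[int]_d) (((h ^~ n) @^-1` B) `*` [set n : Z]).
  apply/seteqP; split => [[q n] /= hB|[q n] /= [m _ [/= hB]] /= ->] //.
  by exists n.
apply: countable_bigcupT_measurable => [|n]; first exact: countableP.
apply: measurableX; last exact: measurable_lattice.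
by rewrite -[X in measurable X]setTI; exact: mh.
Qed.

Definition torus_space : spectral_space R d Z T :=
  @SpectralSpace R d _ Z _ T of_lattice (fun q => repr (q : torus R d))
    (fun m n => n + m) (0 : 'rV[int]_d) (of_lattice0 R d)
    (fun m n => of_latticeD R n m)
    (fun j => measurable_lattice_fun _)
    (fun m => measurable_lattice_fun _)
    (measurable_torus_lattice (fun n =>
      measurable_torus_fun (@continuous_cos R) (fun x y => @cos_phase_lattice x y n)))
    (measurable_torus_lattice (fun n =>
      measurable_torus_fun (@continuous_sin R) (fun x y => @sin_phase_lattice x y n))).

Lemma spectral_torus_ker (K : 'rV[int]_d -> R)
    (mu : {finite_measure set T -> \bar R}) : spectral_measure_torus K mu ->
  forall m n, K (m - n) = ker torus_space mu m n.
Proof.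
case=> _ h m n; have /(congr1 (@complex.Re R)) := h (m - n).
rewrite kerE /= => ->; apply: eq_Rintegral => l _.
by rewrite opp_phaseE cosN of_latticeB.
Qed.

Lemma continuous_enorm : continuous (@enorm R d).
Proof.
move=> x; apply: continuous_comp; last exact: sqrt_continuous.
apply: (continuous_big (op := +%R)) => [|i _ z]; first exact: add_continuous.
by apply: (@continuousM _ _ (fun z : V => z ord0 i)); exact: coord_continuous.
Qed.

(** If [x] is equivalent to [y] in [U], the translation by [y - x] carries a neighbourhood of [x]
    into [U] without changing classes. *)
Lemma open_torus_pi (U : set V) : open U -> open (\pi_(torus R d) @` U).
Proof.
move=> oU; rewrite /open /= /quotient_open openE => x [y Uy yx].
have cx : (fun z : V => z + (y - x)) z @[z --> x] --> y.
  rewrite -[X in _ --> X](subrKC x).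
  apply: cvgD; [exact: (nbhs_filter x)|exact: cvg_id|].
  by apply: (@cvg_cst V (y - x) V (nbhs x) (nbhs_filter x)).
have := cx U (open_nbhs_nbhs (conj oU Uy)).
apply: (@filterS _ (nbhs x) (nbhs_filter x)) => z Uz; exists (z + (y - x)) => //.
apply/(@eqmodP _ (lattice_eq_canonical R d))/forallP => i.
move/torus_pi_eq/forallP: yx => /(_ i); rewrite !mxE.
by congr (_ \is a Num.int); ring.
Qed.

Lemma lattice_eq_small x y : lattice_eq x y -> enorm x < 2^-1 -> enorm y < 2^-1 ->
  x = y.
Proof.
move=> /forallP xy hx hy; apply/rowP => i; apply/eqP; rewrite -subr_eq0.
apply: contraT => /(norm_intr_ge1 (xy i)).
have := abs_coord_le x i; have := abs_coord_le y i.
by have := ler_normB (x ord0 i) (y ord0 i); lra.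
Qed.

(** The ball is the intersection of the images of slightly larger open balls, which are open. The
    bound on [delta] makes short representatives unique, so that one representative works for all of
    them. *)
Lemma measurable_torus_ball (delta : R) : delta < 4^-1 ->
  measurable (torus_ball delta : set T).
Proof.
move=> d4.
have -> : torus_ball delta = \bigcap_(k : nat)
    (\pi_(torus R d) @` [set x : V | enorm x < delta + (k.+1%:R)^-1]).
  apply/seteqP; split => [_ [x hx <-] k _|q hq].
    by exists x => //=; apply: le_lt_trans hx _; rewrite ltrDl invr_gt0 ltr0n.
  (* Index [3] gives the radius [delta + 1 / 4], below the uniqueness threshold [1 / 2]. *)
  have [x hx xq] := hq 3 I.
  have x2 : enorm x < 2^-1 by apply: lt_trans hx _; rewrite -[3.+1%:R]/(4 : R); lra.
  exists x => //=; rewrite /eball /= leNgt; apply/negP => hd.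
  rewrite -subr_gt0 in hd.
  have [k _ /(_ k (leqnn k)) /= hk] := near_infty_natSinv_lt (PosNum hd).
  have [y /= hy yq] := hq k I.
  have y2 : enorm y < enorm x by apply: lt_trans hy _; rewrite addrC -ltrBrDr; exact: hk.
  suff xy : x = y by move: y2; rewrite xy ltxx.
  by apply: lattice_eq_small => //; [apply: torus_pi_eq; rewrite xq yq|lra].
apply: bigcap_measurable => [|k _]; first by exists 0%N.
apply: measurable_borel_open; apply: open_torus_pi.
have /continuousP ce := continuous_enorm.
have := ce _ (@open_lt R (delta + k.+1%:R^-1)); exact.
Qed.

(** The representative chosen by [repr] may be long, whence the separate short vector [y] with the
    same cosines at lattice points. The cap [1 / 4] on [delta] is for measurability. *)
Lemma torus_ball_low (alpha : \bar R) (beta : R)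
    (mu : {finite_measure set T -> \bar R}) :
  log_exponent (fun delta => mu (torus_ball delta)) alpha -> (alpha < beta%:E)%E ->
  exists2 delta0 : R, 0 < delta0 & forall delta, 0 < delta < delta0 ->
    exists A : set T, [/\ measurable A, delta `^ beta <= \int[mu]_l \1_A l &
      forall l, A l -> exists2 y : V, enorm y <= delta &
      forall n, cos (phase (fr torus_space l) (co torus_space n)) =
                cos (phase y (co torus_space n))].
Proof.
move=> h /(log_exponent_low h)[delta0 d0 hd].
exists (Num.min delta0 4^-1); first by rewrite lt_min d0 invr_gt0 ltr0n.
move=> delta; rewrite lt_min => /and3P[delta_gt0 dd d4].
have muE : ((delta `^ beta)%:E <= mu (torus_ball delta))%E.
  by apply: hd; rewrite delta_gt0 dd.
have mA := measurable_torus_ball d4.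
exists (torus_ball delta); split=> //.
  rewrite -lee_fin; apply: le_trans muE _.
  rewrite /Rintegral integral_indic // setIT fineK //; exact: fin_num_measure.
move=> l [y hy yl]; exists y => // n; apply: cos_phase_lattice.
by apply: torus_pi_eq; rewrite reprK yl.
Qed.

End Lattice.

(** * The variance of a Gaussian field *)

Section Gaussian.
Context (R : realType).
Local Notation lambda := (@lebesgue_measure R).

(* [e^v >= 1 + v] with [v = 3 (x - m)^2 / (8 s^2)] trades a polynomial factor
   for a larger variance. *)
Lemma sqr_normal_pdf_le (m s : R) : s != 0 -> exists2 C : R, 0 <= C &
  forall x, x ^+ 2 * normal_pdf m s x <= C * normal_pdf m (2 * s) x.
Proof.
move=> s0; have s2 : 0 < s ^+ 2 by rewrite exprn_even_gt0.
have s20 : 2 * s != 0 by rewrite mulf_neq0 // pnatr_eq0.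
pose D := 2 * m ^+ 2 + 16 / 3 * s ^+ 2.
have D0 : 0 <= D by have := sqr_ge0 m; rewrite /D; lra.
exists (D * (normal_peak s / normal_peak (2 * s))).
  by rewrite mulr_ge0 // divr_ge0 // normal_peak_ge0.
move=> x; rewrite !normal_pdfE //.
rewrite [leRHS](_ : _ = D * normal_peak s * normal_fun m (2 * s) x); last first.
  have := normal_peak_gt0 s20; move: (normal_peak (2 * s)) => p p0.
  by field; rewrite gt_eqF.
rewrite mulrCA -mulrA [leRHS]mulrCA ler_wpM2l ?normal_peak_ge0 //.
pose v := 3 * (x - m) ^+ 2 / (8 * s ^+ 2).
have -> : normal_fun m (2 * s) x = expR v * normal_fun m s x.
  rewrite /normal_fun -expRD /v; congr expR; field; exact: s0.
rewrite mulrA ler_wpM2r ?normal_fun_ge0 //.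
apply: (@le_trans _ _ (D * (1 + v))); last by rewrite ler_wpM2l // expR_ge1Dx.
have v0 : 0 <= v by apply: divr_ge0; apply: mulr_ge0; rewrite ?sqr_ge0.
have -> : x ^+ 2 = (x - m) ^+ 2 + 2 * (x - m) * m + m ^+ 2 by ring.
have vE : (x - m) ^+ 2 = 8 / 3 * s ^+ 2 * v by rewrite /v; field; exact: s0.
have h : 0 <= (x - m - m) ^+ 2 by exact: sqr_ge0.
have h2 : (x - m - m) ^+ 2 = (x - m) ^+ 2 - 2 * (x - m) * m + m ^+ 2 by ring.
have h3 : 0 <= m ^+ 2 * v by rewrite mulr_ge0 ?sqr_ge0.
have h4 : 16 / 3 * s ^+ 2 * v = 2 * (x - m) ^+ 2 by rewrite vE; ring.
have h5 : 0 <= s ^+ 2 by exact: ltW.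
have -> : D * (1 + v) = D + 2 * (m ^+ 2 * v) + 16 / 3 * s ^+ 2 * v by rewrite /D; ring.
by rewrite h4 /D; lra.
Qed.

(** The Radon-Nikodym derivative and the density have the same integrals over measurable sets, so
    they agree almost everywhere. *)
Lemma ge0_integral_normal_prob (m s : R) (f : R -> \bar R) :
  (forall x, 0 <= f x)%E -> measurable_fun setT f ->
  (\int[normal_prob m s]_x f x = \int[lambda]_x (f x * (normal_pdf m s x)%:E))%E.
Proof.
move=> f0 mf; have dom := normal_prob_dominates m s.
have ig := Radon_Nikodym_SigmaFinite.f_integrable dom.
rewrite -(Radon_Nikodym_SigmaFinite.change_of_variables dom f0 measurableT mf).
have mg := measurable_int _ ig.
have mpdf : measurable_fun setT (fun x => (normal_pdf m s x)%:E).
  by apply/measurable_EFinP; apply: measurable_normal_pdf.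
apply: ae_eq_integral => //; first exact: emeasurable_funM.
- exact: emeasurable_funM.
apply: ae_eqe_mul2l; apply: integral_ae_eq => // A _ mA.
by rewrite -(Radon_Nikodym_SigmaFinite.f_integral dom mA).
Qed.

Lemma normal_prob_sqr_lty (m s : R) : s != 0 ->
  (\int[normal_prob m s]_x (x ^+ 2)%:E < +oo)%E.
Proof.
move=> s0; have [C C0 hC] := sqr_normal_pdf_le m s0.
have mX : measurable_fun setT (fun x : R => (x ^+ 2)%:E).
  by apply/measurable_EFinP/measurable_funX.
rewrite ge0_integral_normal_prob //; last first.
  by move=> x; rewrite lee_fin sqr_ge0.
apply: (@le_lt_trans _ _ (\int[lambda]_x (C%:E * (normal_pdf m (2 * s) x)%:E))%E).
  apply: ge0_le_integral => //.
  - by move=> x _; rewrite mule_ge0 // lee_fin ?sqr_ge0 ?normal_pdf_ge0.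
  - by apply/measurable_EFinP/measurable_funM => //; exact: measurable_normal_pdf.
  - by apply/measurable_EFinP/measurable_funM => //; exact: measurable_normal_pdf.
  - by move=> x _; rewrite -!EFinM lee_fin.
rewrite integralZl //; last exact: integrable_normal_pdf.
by rewrite integral_normal_pdf mule1 ltry.
Qed.

Context d0 (Omega : measurableType d0) (P : probability Omega R).

Lemma gaussian_sqr_lty (Y : {RV P >-> R}) : gaussian_rv P Y ->
  (\int[P]_w (Y w ^+ 2)%:E < +oo)%E.
Proof.
move=> [m [s YE]].
have mY : measurable_fun setT (Y : Omega -> measurableTypeR R).
  by move=> _ B mB; exact: measurable_funPT.
pose hY := isMeasurableFun.Build _ _ _ _ _ mY.
pose Y' : {mfun Omega >-> measurableTypeR R} :=
  HB.pack (Y : Omega -> measurableTypeR R) hY.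
have mX : measurable_fun setT (fun x : measurableTypeR R => (x ^+ 2)%:E).
  by apply/measurable_EFinP/measurable_funX.
have -> : (\int[P]_w (Y w ^+ 2)%:E =
    \int[distribution P Y']_x (x ^+ 2)%:E)%E.
  by rewrite ge0_integral_pushforward // => x _; rewrite lee_fin sqr_ge0.
have [s0|s0] := eqVneq s 0.
  rewrite (eq_measure_integral (\d_(m : measurableTypeR R))) => [|A mA _]; last first.
    by have := YE A mA; rewrite s0 eqxx.
  by rewrite integral_dirac // diracT mul1e ltry.
rewrite (eq_measure_integral (normal_prob m s)) => [|A mA _]; last first.
  by have := YE A mA; rewrite (negbTE s0).
exact: normal_prob_sqr_lty.
Qed.

(** For a centred field this is the variance at [0], non-zero by non-degeneracy. Finiteness, from
    the Gaussian law, matters because [fine] would send an infinite variance to [0]. *)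
Lemma sgf_cov_kernel_gt0 (X : zmodType) (f : X -> {RV P >-> R}) :
  is_sgf f -> 0 < cov_kernel f 0.
Proof.
move=> [gf cf nf _].
have g0 : gaussian_rv P (f 0).
  have := gf 1%N (fun=> 0) (fun=> 1).
  by congr gaussian_rv; apply/funext => w; rewrite big_ord1 mul1r.
have V0 := nf 0; have fin := gaussian_sqr_lty g0.
have covE : 'V_P[f 0] = (\int[P]_w (f 0 w ^+ 2)%:E)%E.
  rewrite /variance unlock cf /= unlock; apply: eq_integral => w _ /=.
  by rewrite mulrfctE /= subr0 expr2.
have -> : cov_kernel f 0 = fine 'V_P[f 0].
  by rewrite /cov_kernel covE unlock; congr fine.
rewrite fine_gt0 // lt0e V0 variance_ge0 /= covE; exact: fin.
Qed.

End Gaussian.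

Lemma ker_diag (R : realType) (d : nat) dX (X : measurableType dX)
    dL (L : measurableType dL) (S : spectral_space R d X L)
    (mu : {finite_measure set L -> \bar R}) x : ker S mu x x = fine (mu setT).
Proof.
rewrite kerE subrr; under eq_Rintegral do rewrite /phase dot0r mulr0 cos0.
by rewrite Rintegral_cst // mul1r.
Qed.

Theorem proposition1p6 (R : realType) (d : nat) (d_gt0 : (0 < d)%N)
    (d0 : measure_display) (Omega : measurableType d0)
    (P : probability Omega R) (alpha : \bar R) (alpha_gt0 : (0 < alpha)%E) :
  (forall (f : 'rV[R]_d -> {RV P >-> R}) (K : 'rV[R]_d -> R)
      (mu : {finite_measure set (borel 'rV[R]_d) -> \bar R}),
    sgf_Rd f -> K = cov_kernel f -> spectral_measure_Rd K mu ->
    log_exponent (fun delta => mu (eball delta)) alpha ->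
    ((d%:R - 1)%:E < alpha)%E /\ (forall x, 0 <= K x) \/
    (alpha < (d%:R - 1)%:E)%E /\ radial enorm K /\ eventually_nonneg enorm K ->
    forall eps : R, 0 < eps ->
      asymp_equiv (fun T => Cap_Rd K (eball (T + T `^ (1 - eps))))
                  (fun T => Cap_Rd K (eball T)))
  /\
  (forall (f : 'rV[int]_d -> {RV P >-> R}) (K : 'rV[int]_d -> R)
      (mu : {finite_measure set (borel (torus R d)) -> \bar R}),
    sgf_Zd f -> K = cov_kernel f -> spectral_measure_torus K mu ->
    log_exponent (fun delta => mu (torus_ball delta)) alpha ->
    ((d%:R - 1)%:E < alpha)%E /\ (forall x, 0 <= K x) \/
    (alpha < (d%:R - 1)%:E)%E /\ radial lattice_norm K /\
      eventually_nonneg lattice_norm K ->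
    forall eps : R, 0 < eps ->
      asymp_equiv (fun T => Cap_Zd K (lattice_ball (T + T `^ (1 - eps))))
                  (fun T => Cap_Zd K (lattice_ball T))).
Proof.
have ltd : d%:R - 1 < d%:R :> R by rewrite ltrBlDr ltrDl.
split=> [f K mu [sf _] KE spK hlog hyp eps eps0|f K mu sf KE spK hlog hyp eps eps0].
- have K_gt0 : 0 < K 0 by rewrite KE; apply: sgf_cov_kernel_gt0.
  have kE := spectral_Rd_ker spK.
  apply: (capacity_asymp_cases kE d_gt0 eps0).
  case: hyp => [[_ K0]|[alt [_ [r _ hr]]]]; [left|right].
    (* The total mass of the spectral measure is [K 0], which is positive. *)
    by rewrite -(ker_diag (euclidean_space R d) mu (0 : 'rV[R]_d)) -kE subrr.
  split; first by exists r => x y; exact: hr.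
  have [delta0 delta0_gt0 low] := eball_low hlog alt.
  (* The exponent [d - 1] is strictly above [alpha] and strictly below [d]. *)
  by exists (d%:R - 1), delta0.
- have K_gt0 : 0 < K 0 by rewrite KE; apply: sgf_cov_kernel_gt0.
  have kE := spectral_torus_ker spK.
  apply: (capacity_asymp_cases (X := lattice_space d) kE d_gt0 eps0).
  case: hyp => [[_ K0]|[alt [_ [r _ hr]]]]; [left|right].
    by rewrite -(ker_diag (torus_space R d) mu (0 : 'rV[int]_d)) -kE subrr.
  split; first by exists r => x y; rewrite -of_latticeB; exact: hr.
  have [delta0 delta0_gt0 low] := torus_ball_low hlog alt.
  by exists (d%:R - 1), delta0.
Qed.
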